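(* Let $p>1$ be an integer and $q=1/p$. For every integer $n\ge 1$ let $$b_n = d_{2n-1}(p)^2\,p_{n,n-1}(p^{2n-1}),$$ $$a_n = d_{2n-1}(p)^2\left[r_{n,n-1}(p^{2n-1})+p_{n,n-1}(p^{2n-1})\sum_{k=1}^{2n-2}\frac{k}{p^k-1}+(2n-1)\,q_{n,n-1}(p^{2n-1})\right].$$ Then $a_n,b_n\in\mathbb{Z}$ and $b_n\zeta_q(2)-a_n\neq 0$ for all $n\ge 1$. Furthermore $$\lim_{n\to\infty}\left|b_n\zeta_q(2)-a_n\right|^{1/n^2}\le p^{-\frac{3(\pi^2-8)}{\pi^2}}<1.$$
   Context: $\zeta_q(2)=\sum_{n=1}^\infty \frac{nq^n}{1-q^n}=\sum_{n=1}^\infty\frac{n}{p^n-1}$. $(a;q)_k=\prod_{i=0}^{k-1}(1-aq^i)$. $d_n(x)=\prod_{k=1}^n\Phi_k(x)$, where $\Phi_k$ is the $k$-th cyclotomic polynomial. For integers $0\le m\le n$, $p_{n,m}$ is the polynomial of degree at most $n+m$ (a multiple little $q$-Jacobi polynomial) uniquely determined by $p_{n,m}(0)=1$ and the orthogonality conditions $$\sum_{k=0}^\infty q^k p_{n,m}(q^k)\,q^{k\ell}=0\quad(\ell=0,1,\dots,n-1),\qquad \sum_{k=0}^\infty k\,q^k p_{n,m}(q^k)\,q^{k\ell}=0\quad(\ell=0,1,\dots,m-1).$$ Explicitly, $$p_{n,m}(x)=\sum_{k=0}^m\sum_{j=0}^n\frac{(qx)^{k+j}}{(q;q)_k(q;q)_j}\,\frac{1}{q^{kn}}\,\frac{(q^{n+1};q)_{j+k}}{(q;q)_{j+k}}\,\frac{(q^{n+m+1};q)_k}{(q;q)_k}\,(q^{-n};q)_j(q^{-m};q)_k.$$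 The polynomials $q_{n,m}$ and $r_{n,m}$ are defined by $$q_{n,m}(z)=\sum_{\ell=0}^\infty\frac{p_{n,m}(z)-p_{n,m}(q^\ell)}{z-q^\ell}\,q^\ell,\qquad r_{n,m}(z)=\sum_{\ell=0}^\infty\frac{p_{n,m}(z)-p_{n,m}(q^\ell)}{z-q^\ell}\,\ell\, q^\ell .$$ An empty sum is $0$. *)

(* Defs.v *)
From HB Require Import structures.
From mathcomp Require Import all_boot all_order all_algebra all_field.
From mathcomp Require Import all_classical all_reals all_analysis.

Set Implicit Arguments.
Unset Strict Implicit.
Unset Printing Implicit Defensive.

Import Order.TTheory GRing.Theory Num.Theory.
Import numFieldNormedType.Exports.

Local Open Scope classical_set_scope.
Local Open Scope ring_scope.

(* The library limit [limn] of the partial sums: meaningful only when the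
   series converges, as every series below does for 0 < q < 1. *)
Definition sum_from (R : realType) (m : nat) (u : nat -> R) : R :=
  \big[+%R/0]_(m <= k <oo) u k.

Definition zeta_q2 (R : realType) (q : R) : R :=
  sum_from 1 (fun n => n%:R * q ^+ n / (1 - q ^+ n)).

Definition dPhi (n : nat) : {poly int} := \prod_(1 <= k < n.+1) 'Phi_k.

(* Multiple little q-Jacobi polynomial p_{n,m}; the size of a polynomial is
   its degree plus one. *)
Definition is_mlqJacobi (R : realType) (q : R) (n m : nat) (P : {poly R}) :
    Prop :=
  [/\ (size P <= (n + m).+1)%N,
      P.[0] = 1,
      forall l : nat, (l < n)%N ->
        sum_from 0 (fun k => q ^+ k * P.[q ^+ k] * q ^+ (k * l)) = 0
    & forall l : nat, (l < m)%N ->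
        sum_from 0 (fun k => k%:R * q ^+ k * P.[q ^+ k] * q ^+ (k * l)) = 0].

(* p_{n,m}: the polynomial determined by the properties above (which have a
   unique solution for 0 < q < 1 and m <= n). *)
Definition mlqJacobi (R : realType) (q : R) (n m : nat) : {poly R} :=
  xget 0 [set P : {poly R} | is_mlqJacobi q n m P].

(* Values of the polynomials q_{n,m} and r_{n,m} at a point z which is not a
   power q ^+ l; at such a power the divided difference would have to be read
   as a derivative, whereas the l-th term below is 0. *)
Definition mlqJ_q (R : realType) (q : R) (n m : nat) (z : R) : R :=
  let P := mlqJacobi q n m in
  sum_from 0 (fun l => (P.[z] - P.[q ^+ l]) / (z - q ^+ l) * q ^+ l).

Definition mlqJ_r (R : realType) (q : R) (n m : nat) (z : R) : R :=
  let P := mlqJacobi q n m in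
  sum_from 0 (fun l => (P.[z] - P.[q ^+ l]) / (z - q ^+ l) * l%:R * q ^+ l).

(* For n >= 1 none of the natural number subtractions in [b_] and [a_] is
   truncated, and for n = 1 the sum in [a_] is empty. *)
Definition b_ (R : realType) (p n : nat) : R :=
  let q : R := p%:R^-1 in
  let z : R := p%:R ^+ (2 * n - 1) in
  ((dPhi (2 * n - 1)).[p%:Z])%:~R ^+ 2 * (mlqJacobi q n n.-1).[z].

Definition a_ (R : realType) (p n : nat) : R :=
  let q : R := p%:R^-1 in
  let z : R := p%:R ^+ (2 * n - 1) in
  ((dPhi (2 * n - 1)).[p%:Z])%:~R ^+ 2 *
  (mlqJ_r q n n.-1 z
   + (mlqJacobi q n n.-1).[z]
     * (\sum_(1 <= k < (2 * n - 2).+1) k%:R / (p%:R ^+ k - 1))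
   + (2 * n - 1)%:R * mlqJ_q q n n.-1 z).

(* Main.v *)
Require Import Defs.
From mathcomp Require Import all_boot all_order all_algebra all_field.
From mathcomp Require Import all_classical all_reals all_analysis.
From mathcomp Require Import ring lra zify.
Import Order.TTheory GRing.Theory Num.Theory.
Import numFieldNormedType.Exports.
Local Open Scope classical_set_scope.
Local Open Scope ring_scope.

Set Implicit Arguments.
Unset Strict Implicit.
Unset Printing Implicit Defensive.

(* Put [N = 2 n - 1], [z = p ^ N] and [P = p_(n,n-1)]. The generating function
   [S(x) = sum_k q^k P(q^k) x^k] is rational with poles at the points
   [p ^ (i + 1)], [i <= N], and the orthogonality conditions say that its
   numerator vanishes at [1, q, ..., q^(n-1)], doubly at all of these but the
   last. Hence the numerator is known up to a constant, and partial fractions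
   give the coefficients of [P]: up to sign, those of [P(z x)] are powers of [p]
   times Gaussian binomials. Expanding [1 / (1 - q^j)] in powers of [p^j] up to order
   [N] expresses [q_(n,n-1)(z)] and [r_(n,n-1)(z)] through the values
   [P(p^t)], [1 <= t <= N], which are integers because they are divided
   differences of integer polynomials; the other denominators are
   [p^j - 1] with [j <= N].

   Moreover [(b_n zeta_q(2) - a_n) / d_N(p)^2] is
   [sum_k z^-(k+1) (q^k S'(q^k) + N S(q^k))]. The terms with [k < n - 1] vanish,
   the term [k = n - 1] is positive, and the later ones are negative but add up
   to at most [19/20] of it. That term is explicit and equals
   [p ^ (- 3 n^2 + O(n))], so only the growth of [d_N(p)] remains:
   [sum_(j <= n) ln d_(n/j)(p) = sum_(k <= n) ln (p^k - 1)], with [n/j] rounded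
   down, forces
   [ln d_n(p) ~ (3 / pi^2) n^2 ln p] by a Tauberian argument and Euler's
   [sum 1/k^2 = pi^2/6]. The bound of the theorem is therefore the exact limit. *)

(** * Series *)

Lemma sum_from0E (R : realType) (u : nat -> R) (l : R) :
  series u @ \oo --> l -> sum_from 0 u = l.
Proof. by move=> h; rewrite /sum_from; apply/cvg_lim. Qed.

Lemma cvg_seriesD (R : realType) (u v : nat -> R) (a b : R) :
  series u @ \oo --> a -> series v @ \oo --> b ->
  series (fun k => u k + v k) @ \oo --> a + b.
Proof.
move=> hu hv; have -> : series (fun k => u k + v k) = series u + series v.
  by rewrite -seriesD.
exact: cvgD.
Qed.

Lemma cvg_seriesZ (R : realType) (u : nat -> R) (a c : R) :
  series u @ \oo --> a -> series (fun k => c * u k) @ \oo --> c * a.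
Proof.
move=> hu.
have -> : series (fun k => c * u k) = (fun n => c * series u n).
  by apply/funext => n; rewrite /series /= big_distrr.
exact: cvgMr.
Qed.

Lemma cvg_seriesB (R : realType) (u v : nat -> R) (a b : R) :
  series u @ \oo --> a -> series v @ \oo --> b ->
  series (fun k => u k - v k) @ \oo --> a - b.
Proof.
move=> hu hv; have -> : (fun k => u k - v k) = (fun k => u k + (-1) * v k).
  by apply/funext => k; rewrite mulN1r.
rewrite -[- b]mulN1r; apply: cvg_seriesD => //; exact: cvg_seriesZ.
Qed.

Lemma cvg_series_sum (R : realType) (I : Type) (r : seq I)
    (u : I -> nat -> R) (a : I -> R) :
  (forall i, series (u i) @ \oo --> a i) ->
  series (fun k => \sum_(i <- r) u i k) @ \oo --> \sum_(i <- r) a i.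
Proof.
move=> h; elim: r => [|i r IH].
  rewrite big_nil (_ : series _ = fun=> 0); first exact: cvg_cst.
  by apply/funext => n; rewrite /series /= big1 // => k _; rewrite big_nil.
rewrite big_cons (_ : (fun k => _) = fun k => u i k + \sum_(j <- r) u j k).
  exact: cvg_seriesD.
by apply/funext => k; rewrite big_cons.
Qed.

Lemma cvg_series_shift (R : realType) (u : nat -> R) (a : R) (N : nat) :
  series u @ \oo --> a ->
  series (fun k => u (k + N)%N) @ \oo --> a - \sum_(0 <= k < N) u k.
Proof.
move=> hu.
have -> : series (fun k => u (k + N)%N) =
          (fun n => series u (n + N)%N - \sum_(0 <= k < N) u k).
  apply/funext => n; rewrite /series /= [in RHS](@big_cat_nat _ _ _ N) //=.
    by rewrite [X in _ = X - _]addrC addrK -{2}[N]add0n big_addn addnK.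
  exact: leq_addl.
apply: cvgB; last exact: cvg_cst.
by rewrite (cvg_shiftn N (series u)).
Qed.

Lemma cvg_geo (R : realType) (x : R) : 0 <= x < 1 ->
  series (fun k => x ^+ k) @ \oo --> (1 - x)^-1.
Proof.
move=> /andP[x0 x1]; have := @cvg_geometric_series R 1 x.
rewrite ger0_norm // div1r => /(_ x1).
rewrite (_ : geometric 1 x = fun k => x ^+ k) //.
by apply/funext => k; rewrite /= mul1r.
Qed.

Lemma bernoulli_ineq (R : realType) (h : R) (n : nat) :
  0 <= h -> 1 + n%:R * h <= (1 + h) ^+ n.
Proof.
move=> h0; elim: n => [|n IH]; first by rewrite mul0r addr0 expr0.
rewrite exprS; apply: (le_trans _ (ler_wpM2l _ IH)); last by lra.
rewrite -natr1; have : 0 <= n%:R :> R by [].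
nra.
Qed.

(** Write [x = y^2] and [1/y = 1 + h]. Bernoulli's inequality gives [n h y^n <= 1], so
    [n x^n <= y^n / h], which tends to zero. *)
Lemma cvg_mulXn (R : realType) (x : R) : 0 <= x < 1 ->
  (fun n : nat => n%:R * x ^+ n) @ \oo --> (0 : R).
Proof.
move=> /andP[x0 x1]; have [->|xn0] := eqVneq x 0.
  rewrite (_ : (fun n => _) = fun=> 0); first exact: cvg_cst.
  by apply/funext => -[|n]; rewrite ?mul0r // expr0n mulr0.
have xp : 0 < x by rewrite lt_def xn0.
pose y := Num.sqrt x.
have yp : 0 < y by rewrite sqrtr_gt0.
have yE : x = y * y by rewrite -expr2 sqr_sqrtr.
have y1 : y < 1 by nra.
pose h := y^-1 - 1.
have hp : 0 < h by rewrite subr_gt0 invf_gt1.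
apply: (@squeeze_cvgr _ _ _ _ (fun=> 0) (fun n => h^-1 * y ^+ n)).
- near=> n; apply/andP; split; first by rewrite mulr_ge0 // exprn_ge0.
  have e0 : 0 < y ^+ n by rewrite exprn_gt0.
  have hE : 1 + h = y^-1 by rewrite /h addrC subrK.
  have := @bernoulli_ineq _ h n (ltW hp).
  rewrite hE exprVn -[_^-1]mul1r ler_pdivlMr // => H.
  rewrite yE exprMn ler_pdivlMl //.
  have : ((1 + n%:R * h) * y ^+ n) * y ^+ n <= 1 * y ^+ n by rewrite ler_wpM2r // ltW.
  nra.
- exact: cvg_cst.
- rewrite -[0](mulr0 h^-1); apply: cvgMr; apply: cvg_expr.
  by rewrite ger0_norm // ltW.
Unshelve. all: by end_near. Qed.

Lemma cvg_arithgeo (R : realType) (x : R) : 0 <= x < 1 ->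
  series (fun k => k%:R * x ^+ k) @ \oo --> x / (1 - x) ^+ 2.
Proof.
move=> hx; have /andP[x0 x1] := hx.
have x1n : 1 - x != 0 by rewrite subr_eq0 gt_eqF.
have -> : series (fun k => k%:R * x ^+ k) =
  (fun n => x / (1 - x) * series (fun k => x ^+ k) n
            - (1 - x)^-1 * (n%:R * x ^+ n)).
  apply/funext; elim=> [|n IH].
    by rewrite /series /= !big_geq // mul0r !mulr0 subr0.
  have E (s u v : R) : x / (1 - x) * s - (1 - x)^-1 * (v * u) + v * u =
      x / (1 - x) * (s + u) - (1 - x)^-1 * ((v + 1) * (x * u)) by field.
  by rewrite !seriesSr IH /= -natr1 exprS; exact: E.
rewrite (_ : x / (1 - x) ^+ 2 = x / (1 - x) * (1 - x)^-1 - (1 - x)^-1 * 0); last first.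
  by field.
apply: cvgB; apply: cvgMr; [exact: cvg_geo | exact: cvg_mulXn].
Qed.

(** * The Basel sum *)

Lemma sin_le_id (R : realType) (x : R) : 0 < x < pi / 2 -> sin x <= x.
Proof.
move=> /andP[x0 x1].
have [c _ E] := @MVT_segment R sin cos 0 x (ltW x0)
  (fun y _ => is_derive_sin y) (continuous_subspaceT (@continuous_sin R)).
move: E; rewrite sin0 !subr0 => ->.
by rewrite ler_piMl ?cos_le1 // ltW.
Qed.

Lemma id_le_tan (R : realType) (x : R) : 0 < x < pi / 2 -> x <= tan x.
Proof.
move=> /andP[x0 x1].
have cp (y : R) : 0 <= y <= x -> 0 < cos y.
  move=> /andP[y0 yx]; apply: cos_gt0_pihalf; rewrite (le_lt_trans yx x1) andbT.
  by rewrite (lt_le_trans _ y0) // oppr_lt0 divr_gt0 // pi_gt0.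
have [||c /itvP cI] := @MVT_segment R tan (fun y => (cos y) ^- 2) 0 x (ltW x0).
- by move=> y /itvP yI; apply: is_derive_tan; rewrite gt_eqF // cp // !yI.
- apply/continuous_in_subspaceT => y; rewrite mem_setE => /itvP yI.
  by apply: continuous_tan; rewrite gt_eqF // cp // !yI.
rewrite tan0 !subr0 => ->; rewrite ler_peMl ?(ltW x0) //.
have c0 : 0 < cos c by rewrite cp // !cI.
by rewrite invf_ge1 ?exprn_gt0 // exprn_ile1 ?ltW // cos_le1.
Qed.

(** Invert and square [sin x <= x <= tan x], using [1/tan^2 = 1/sin^2 - 1]. *)
Lemma inv_sqr_bounds (R : realType) (x : R) : 0 < x < pi / 2 ->
  (sin x) ^- 2 - 1 <= x ^- 2 <= (sin x) ^- 2.
Proof.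
move=> hx; have /andP[x0 x1] := hx.
have s0 : 0 < sin x by rewrite sin_gt0_pihalf.
have c0 : 0 < cos x.
  apply: cos_gt0_pihalf; rewrite x1 andbT (lt_trans _ x0) //.
  by rewrite oppr_lt0 divr_gt0 // pi_gt0.
have sx := sin_le_id hx; have xt := id_le_tan hx.
apply/andP; split; last by rewrite lef_pV2 ?posrE ?exprn_gt0 // lerXn2r ?nnegrE // ltW.
have -> : (sin x) ^- 2 - 1 = (tan x) ^- 2.
  rewrite /tan expr_div_n invf_div cos2sin2; field.
  by rewrite gt_eqF.
have t0 : 0 < tan x by rewrite divr_gt0.
by rewrite lef_pV2 ?posrE ?exprn_gt0 // lerXn2r ?nnegrE // ltW.
Qed.

Lemma inv_sin_sqr_half (R : realType) (x : R) : 0 < x < pi / 2 ->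
  (sin (x / 2)) ^- 2 + (sin ((pi - x) / 2)) ^- 2 = 4 * (sin x) ^- 2.
Proof.
move=> /andP[x0 x1]; have p0 := @pi_gt0 R.
have -> : sin ((pi - x) / 2) = cos (x / 2).
  by rewrite -cosBpihalf -cosN; congr cos; field.
have -> : sin x = 2 * (sin (x / 2) * cos (x / 2)).
  rewrite mulrC mulr_natr [sin _ * _]mulrC -sin_mulr2n; congr sin.
  by field.
have s0 : sin (x / 2) != 0 by rewrite gt_eqF // sin_gt0_pihalf //; lra.
have c0 : cos (x / 2) != 0 by rewrite gt_eqF // cos_gt0_pihalf //; lra.
have E : (sin (x/2)) ^+ 2 = 1 - (cos (x/2)) ^+ 2 by rewrite sin2cos2.
have -> : 4 * (2 * (sin (x / 2) * cos (x / 2))) ^- 2 =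
   ((sin (x / 2)) ^+ 2 + (cos (x / 2)) ^+ 2) / ((sin (x / 2) * cos (x / 2)) ^+ 2).
  by rewrite E subrK; field; rewrite s0 c0.
by field; rewrite s0 c0.
Qed.

(** Induction on [r]: the angles of level [r + 1] fall into pairs [x/2], [(pi - x)/2] with [x] an
    angle of level [r], and each pair contributes four times the term of [x]. *)
Lemma sum_inv_sin_sqr (R : realType) (r : nat) :
  \sum_(0 <= k < 2 ^ r) (sin ((2 * k + 1)%:R * pi / 2 ^+ r.+2 : R)) ^- 2 =
  2 * 4 ^+ r.
Proof.
have p0 := @pi_gt0 R.
elim: r => [|r IH].
  rewrite expn0 big_nat1 expr0 mulr1 mul1r.
  have E : cos (pi / 4) = sin (pi / 4) :> R.
    by rewrite -cosBpihalf -cosN; congr cos; field.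
  have := cos2Dsin2 (pi / 4 : R); rewrite E => E2.
  have -> : pi / 2 ^+ 2 = pi / 4 :> R by congr (_ / _); ring.
  have -> : sin (pi / 4) ^+ 2 = 1 / 2 :> R by lra.
  by field.
rewrite [4 ^+ _]exprS mulrCA -IH big_distrr /= expnS mul2n -addnn.
rewrite (@big_cat_nat _ _ _ (2 ^ r)) ?leq_addr //=.
(* Reversing the upper half matches each index [k] with its mirror image, whose angle is [pi/2]
   minus that of [k]. *)
rewrite (big_nat_rev _ _ (2 ^ r)%N (2 ^ r + 2 ^ r)%N) /=.
have shift (n : nat) (F : nat -> R) :
    \sum_(n <= i < n + n) F i = \sum_(0 <= i < n) F (i + n)%N.
  by rewrite -{1}[n]add0n big_addn addnK.
rewrite shift -big_split /=.
apply: eq_big_nat => k /andP[_ kr].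
have p2 : 0 < 2 ^+ r :> R by rewrite exprn_gt0.
have kR : (2 * k + 1)%:R < 2 * 2 ^+ r :> R.
  by rewrite -natrX -natrM ltr_nat; lia.
rewrite -inv_sin_sqr_half; last first.
  apply/andP; split; first by rewrite divr_gt0 ?exprn_gt0 ?mulr_gt0 ?ltr0n ?addn1 ?pi_gt0.
  rewrite ltr_pdivrMr ?exprn_gt0 // !exprS.
  have -> : pi / 2 * (2 * (2 * 2 ^+ r)) = (2 * 2 ^+ r) * pi :> R by field.
  by rewrite ltr_pM2r.
congr ((sin _) ^- 2 + (sin _) ^- 2).
  by rewrite (exprSr _ r.+2); field; rewrite expf_neq0.
have -> : (2 * (2 ^ r + (2 ^ r + 2 ^ r) - (k + 2 ^ r).+1) + 1 = 4 * 2 ^ r - (2 * k + 1))%N.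
  lia.
rewrite natrB; last by lia.
rewrite !exprS natrM natrX; field.
by rewrite gt_eqF.
Qed.

Definition inv_sqr_sum (R : realType) (n : nat) : R := \sum_(0 <= k < n) (k.+1)%:R ^- 2.

Definition inv_odd_sqr_sum (R : realType) (n : nat) : R :=
  \sum_(0 <= k < n) (2 * k + 1)%:R ^- 2.

(** Sum [inv_sqr_bounds] over the angles of [sum_inv_sin_sqr]. The [2 ^ r] subtracted ones cost
    [pi^2 / (16 * 2^r)] after rescaling by [pi^2 / (16 * 4^r)]. *)
Lemma inv_odd_sqr_sum_bounds (R : realType) (r : nat) :
  pi ^+ 2 / 8 - pi ^+ 2 / (16 * 2 ^+ r) <= inv_odd_sqr_sum R (2 ^ r) <= pi ^+ 2 / 8.
Proof.
have p0 := @pi_gt0 R; have p2 : 0 < 2 ^+ r :> R by rewrite exprn_gt0.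
have E4 : 4 ^+ r = 2 ^+ r * 2 ^+ r :> R by rewrite -exprMn; congr (_ ^+ _); ring.
have E : inv_odd_sqr_sum R (2 ^ r) = pi ^+ 2 / (16 * 4 ^+ r) *
    \sum_(0 <= k < 2 ^ r) ((2 * k + 1)%:R * pi / 2 ^+ r.+2) ^- 2.
  rewrite big_distrr; apply: eq_bigr => k _ /=; rewrite E4 !exprS.
  have : (2 * k + 1)%:R != 0 :> R by rewrite pnatr_eq0 addn1.
  have p0n : pi != 0 :> R by rewrite gt_eqF.
  move: (_%:R) (pi) p0n => u v v0 u0; field; by rewrite u0 v0 gt_eqF.
have hk k : (0 <= k < 2 ^ r)%N -> (0 : R) < (2 * k + 1)%:R * pi / 2 ^+ r.+2 < (pi / 2 : R).
  move=> kr.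
  have kR : (2 * k + 1)%:R < 2 * 2 ^+ r :> R.
    by rewrite -natrX -natrM ltr_nat; lia.
  apply/andP; split; first by rewrite divr_gt0 ?exprn_gt0 ?mulr_gt0 ?ltr0n ?addn1 ?pi_gt0.
  rewrite ltr_pdivrMr ?exprn_gt0 // !exprS.
  have -> : pi / 2 * (2 * (2 * 2 ^+ r)) = (2 * 2 ^+ r) * pi :> R by field.
  by rewrite ltr_pM2r.
have c0 : 0 < pi ^+ 2 / (16 * 4 ^+ r) :> R by rewrite divr_gt0 ?exprn_gt0 ?mulr_gt0 ?ltr0n ?addn1.
rewrite E; apply/andP; split; last first.
  rewrite (_ : pi ^+ 2 / 8 = pi ^+ 2 / (16 * 4 ^+ r) * (2 * 4 ^+ r)); last first.
    by field; rewrite expf_neq0.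
  rewrite ler_pM2l // -sum_inv_sin_sqr; apply: ler_sum_nat => k /hk hx.
  by have /andP[] := inv_sqr_bounds hx.
rewrite (_ : pi ^+ 2 / 8 - _ = pi ^+ 2 / (16 * 4 ^+ r) * (2 * 4 ^+ r - 2 ^+ r)); last first.
  by rewrite E4; field; rewrite gt_eqF.
rewrite ler_pM2l // -sum_inv_sin_sqr.
have -> : 2 ^+ r = \sum_(0 <= k < 2 ^ r) (1 : R).
  by rewrite sumr_const_nat subn0 -natrX.
rewrite -sumrB; apply: ler_sum_nat => k /hk hx.
by have /andP[] := inv_sqr_bounds hx.
Qed.

Lemma inv_sqr_sum_double (R : realType) (n : nat) :
  inv_sqr_sum R (2 * n) = inv_odd_sqr_sum R n + inv_sqr_sum R n / 4.
Proof.
elim: n => [|n IH]; first by rewrite /inv_sqr_sum /inv_odd_sqr_sum !big_geq // mul0r addr0.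
have -> : (2 * n.+1 = (2 * n).+2)%N by lia.
rewrite /inv_sqr_sum /inv_odd_sqr_sum !big_nat_recr //=.
rewrite -/(inv_sqr_sum _ _) -/(inv_odd_sqr_sum _ _) -/(inv_sqr_sum R n) IH.
have -> : (2 * n).+2%:R = 2 * n.+1%:R :> R by rewrite -natrM; congr (_ %:R); lia.
have n1 : n.+1%:R != 0 :> R by rewrite pnatr_eq0.
have n2 : (2 * n).+1%:R != 0 :> R by rewrite pnatr_eq0.
rewrite addn1; move: (n.+1%:R) ((2 * n).+1%:R) n1 n2 => u v u0 v0.
by field; rewrite u0 v0.
Qed.

Lemma inv_sqr_sum_homo (R : realType) (m n : nat) :
  (m <= n)%N -> inv_sqr_sum R m <= inv_sqr_sum R n.
Proof.
by move=> mn; rewrite /inv_sqr_sum (@big_cat_nat _ _ _ m 0 n) //= lerDl sumr_ge0.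
Qed.

(** Doubling the range gives [s(n) <= s(2n) <= pi^2/8 + s(n)/4], to be solved for [s(n)]. *)
Lemma inv_sqr_sum_le (R : realType) (n : nat) : inv_sqr_sum R n <= pi ^+ 2 / 6.
Proof.
have h : inv_odd_sqr_sum R n <= pi ^+ 2 / 8.
  have /andP[_] := inv_odd_sqr_sum_bounds R n; apply: le_trans.
  rewrite /inv_odd_sqr_sum (@big_cat_nat _ _ _ n 0 (2 ^ n)) //= ?lerDl ?sumr_ge0 //.
  by rewrite ltnW // ltn_expl.
have := inv_sqr_sum_double R n.
have : inv_sqr_sum R n <= inv_sqr_sum R (2 * n) by apply: inv_sqr_sum_homo; lia.
lra.
Qed.

(** The error fits the doubling recurrence exactly: [1/16 + (1/4)/4 = (1/4)/2]. *)
Lemma inv_sqr_sum_ge (R : realType) (r : nat) :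
  pi ^+ 2 / 6 - pi ^+ 2 / (4 * 2 ^+ r) <= inv_sqr_sum R (2 ^ r).
Proof.
have p0 := @pi_gt0 R.
elim: r => [|r IH].
  rewrite expr0 /inv_sqr_sum big_nat1 expr1n invr1.
  have : 0 < pi ^+ 2 :> R by rewrite exprn_gt0.
  lra.
rewrite expnS inv_sqr_sum_double; have /andP[h _] := inv_odd_sqr_sum_bounds R r.
have p2 : 0 < 2 ^+ r :> R by rewrite exprn_gt0.
rewrite [2 ^+ r.+1]exprS; move: h IH; set s := inv_sqr_sum _ _; set o := inv_odd_sqr_sum _ _.
have -> : pi ^+ 2 / (16 * 2 ^+ r) = pi ^+ 2 / 2 ^+ r / 16 :> R by field; rewrite gt_eqF.
have -> : pi ^+ 2 / (4 * 2 ^+ r) = pi ^+ 2 / 2 ^+ r / 4 :> R by field; rewrite gt_eqF.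
have -> : pi ^+ 2 / (4 * (2 * 2 ^+ r)) = pi ^+ 2 / 2 ^+ r / 8 :> R by field; rewrite gt_eqF.
lra.
Qed.

(** Three terms of the Basel sum, [1 + 1/4 + 1/9 = 49/36], already give [pi^2 >= 49/6]. The strict
    inequality [< 1] of the theorem rests on this. *)
Lemma pi_sqr_gt8 (R : realType) : 8 < pi ^+ 2 :> R.
Proof.
have := inv_sqr_sum_le R 3; rewrite /inv_sqr_sum !big_nat_recr //= big_geq // add0r expr1n invr1.
rewrite -!exprVn; lra.
Qed.

Lemma inv_sqr_sum_telescope_le (R : realType) (n : nat) : inv_sqr_sum R n.+2 <= 7 / 4 - n.+2%:R^-1.
Proof.
elim: n => [|n IH].
  by rewrite /inv_sqr_sum !big_nat_recr //= big_geq // add0r expr1n invr1; lra.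
rewrite /inv_sqr_sum big_nat_recr //= -/(inv_sqr_sum R n.+2) -[n.+3%:R]natr1.
have : 1 <= n.+2%:R :> R by rewrite ler1n.
move: (n.+2%:R : R) IH => u IH u1.
have u0 : 0 < u by lra.
suff : (u + 1) ^- 2 <= u^-1 - (u + 1)^-1 by move: IH; lra.
have -> : u^-1 - (u + 1)^-1 = (u * (u + 1))^-1 by field; rewrite !gt_eqF //; lra.
rewrite lef_pV2 ?posrE ?exprn_gt0 ?mulr_gt0 //; nra.
Qed.

Lemma inv_sqr_sum_tail_le (R : realType) (n : nat) : inv_sqr_sum R n - 1 <= 3 / 4.
Proof.
case: n => [|[|n]].
- by rewrite /inv_sqr_sum big_geq //; lra.
- by rewrite /inv_sqr_sum big_nat1 expr1n invr1; lra.
- have := inv_sqr_sum_telescope_le R n; have : 0 < n.+2%:R^-1 :> R by rewrite invr_gt0 ltr0n.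
  by move: (inv_sqr_sum R n.+2) (_^-1) => x y; lra.
Qed.

Lemma inv_sqr_sumE (R : realType) (n : nat) : inv_sqr_sum R n = \sum_(1 <= j < n.+1) j%:R ^- 2.
Proof. by rewrite big_add1. Qed.

(** * A Tauberian argument for sums over [n %/ j] *)

Lemma mul_le_sqr (R : realType) (e t x : R) : 0 < e -> t * x <= e * x ^+ 2 + t ^+ 2 / e.
Proof.
move=> e0; rewrite -subr_ge0.
have -> : e * x ^+ 2 + t ^+ 2 / e - t * x =
  e^-1 * ((e * x - t / 2) ^+ 2 + t ^+ 2 * (3 / 4)) by field; rewrite gt_eqF.
by rewrite mulr_ge0 ?invr_ge0 ?(ltW e0) // addr_ge0 ?sqr_ge0 // mulr_ge0 ?sqr_ge0 //; lra.
Qed.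

Lemma natr_divn_le (R : realType) (n j : nat) : (0 < j)%N -> (n %/ j)%:R <= n%:R / j%:R :> R.
Proof. by move=> j0; rewrite ler_pdivlMr ?ltr0n // -natrM ler_nat leq_divM. Qed.

Lemma natr_divn_ge (R : realType) (n j : nat) :
  (0 < j)%N -> n%:R / j%:R - 1 <= (n %/ j)%:R :> R.
Proof.
move=> j0; rewrite lerBlDr ler_pdivrMr ?ltr0n // natr1 -natrM ler_nat.
by rewrite {1}(divn_eq n j) mulSn addnC leq_add2r ltnW // ltn_pmod.
Qed.

(* Since [sum_(j >= 2) 1/j^2 <= 3/4], isolating the term [j = 1] turns a bound
   [b * n^2] on [g] into the bound [7/8 * b * n^2]. *)
Lemma divn_sum_contract (R : realType) (g : nat -> R) (b : R) : 0 < b ->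
  (forall e : R, 0 < e -> exists K : R, forall n,
     `|\sum_(1 <= j < n.+1) g (n %/ j)%N| <= e * n%:R ^+ 2 + K) ->
  (exists K : R, forall n, `|g n| <= b * n%:R ^+ 2 + K) ->
  exists K : R, forall n, `|g n| <= 7 / 8 * b * n%:R ^+ 2 + K.
Proof.
move=> b0 H [K0 HK0].
have K00 : 0 <= K0 by have := HK0 0%N; rewrite expr0n mulr0 add0r; apply: le_trans.
(* The tail takes [3/4]; two shares of [1/16], one for the hypothesis and one for absorbing the
   linear term [K0 * n], complete it to [7/8]. *)
have e0 : 0 < b / 16 by lra.
have [K1 HK1] := H _ e0.
have K10 : 0 <= K1 by have := HK1 0%N; rewrite expr0n mulr0 add0r; apply: le_trans.
pose K := K1 + K0 ^+ 2 / (b / 16) + K0.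
exists K => -[|n].
  apply: (le_trans (HK0 0%N)); rewrite expr0n !mulr0 !add0r /K lerDr addr_ge0 //.
  by rewrite divr_ge0 ?sqr_ge0 // ltW.
have := HK1 n.+1; rewrite big_nat_recl // divn1 => h1.
have E : g n.+1 = (g n.+1 + \sum_(1 <= i < n.+1) g (n.+1 %/ i.+1)%N) -
   \sum_(1 <= i < n.+1) g (n.+1 %/ i.+1)%N by rewrite addrK.
rewrite E; apply: (le_trans (ler_normB _ _)).
have h2 : `|\sum_(1 <= i < n.+1) g (n.+1 %/ i.+1)%N| <=
    b * n.+1%:R ^+ 2 * (inv_sqr_sum R n.+1 - 1) + K0 * n.+1%:R.
  apply: (le_trans (ler_norm_sum _ _ _)).
  apply: (@le_trans _ _ (\sum_(1 <= i < n.+1) (b * n.+1%:R ^+ 2 * i.+1%:R ^- 2 + K0))).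
    apply: ler_sum => i _; apply: (le_trans (HK0 _)).
    rewrite lerD2r -mulrA ler_pM2l // -exprVn -exprMn lerXn2r ?nnegrE //.
    exact: natr_divn_le.
  rewrite big_split /= -big_distrr /= sumr_const_nat subn1 /=.
  apply: lerD; last by rewrite -[K0 *+ _]mulr_natr ler_wpM2l // ler_nat.
  rewrite ler_wpM2l ?mulr_ge0 ?exprn_ge0 ?(ltW b0) //.
  rewrite /inv_sqr_sum [X in _ <= X - 1]big_nat_recl // expr1n invr1 [1 + _]addrC addrK.
  by rewrite big_add1.
have h3 := inv_sqr_sum_tail_le R n.+1.
have h4 : 0 <= b * n.+1%:R ^+ 2 by rewrite mulr_ge0 ?exprn_ge0 // ltW.
have h5 := mul_le_sqr K0 n.+1%:R e0.
have h6 := ler_wpM2l h4 h3.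
rewrite /K.
lra.
Qed.

(** Iterating the contraction [k] times replaces [b] by [(7/8)^k * b], eventually below any [e];
    only the additive constant depends on [k]. *)
Lemma divn_sum_little_o (R : realType) (g : nat -> R) (b : R) : 0 < b ->
  (forall e : R, 0 < e -> exists K : R, forall n,
     `|\sum_(1 <= j < n.+1) g (n %/ j)%N| <= e * n%:R ^+ 2 + K) ->
  (forall n, `|g n| <= b * n%:R ^+ 2) ->
  forall e, 0 < e -> exists K : R, forall n, `|g n| <= e * n%:R ^+ 2 + K.
Proof.
move=> b0 H Hb e e0.
have P k : exists K : R, forall n, `|g n| <= (7 / 8) ^+ k * b * n%:R ^+ 2 + K.
  elim: k => [|k IH]; first by exists 0 => n; rewrite expr0 mul1r addr0.
  rewrite exprS -mulrA; apply: divn_sum_contract => //.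
  by rewrite mulr_gt0 // exprn_gt0.
have /cvgrPdist_le/(_ (e / b)) : (fun n : nat => (7 / 8 : R) ^+ n) @ \oo --> (0 : R).
  by apply: cvg_expr; rewrite ger0_norm; lra.
rewrite divr_gt0 // => /(_ isT)[k _ /(_ k (leqnn k))] /=.
rewrite sub0r normrN ger0_norm ?exprn_ge0 // ler_pdivlMr // => hk.
have [K HK] := P k; exists K => n; apply: (le_trans (HK n)).
by rewrite lerD2r ler_wpM2r ?exprn_ge0.
Qed.

(** Without the rounding, the sum is [n^2] times a partial Basel sum. Hence [3/pi^2 * n^2] has the
    same leading term [n^2/2] of its floor sums as [psi] below. *)
Lemma sum_divn_sqr (R : realType) (e : R) : 0 < e ->
  exists K : R, forall n,
    `|3 / pi ^+ 2 * (\sum_(1 <= j < n.+1) (n %/ j)%N%:R ^+ 2) - n%:R ^+ 2 / 2|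
      <= e * n%:R ^+ 2 + K.
Proof.
move=> e0; have p8 := @pi_sqr_gt8 R.
have p0 : 0 < pi ^+ 2 :> R by lra.
pose c : R := 3 / pi ^+ 2.
have c0 : 0 < c by rewrite divr_gt0.
have c1 : c <= 1 by rewrite ler_pdivrMr //; lra.
have cE : c * (pi ^+ 2 / 6) = 1 / 2
  by rewrite /c; move: (pi ^+ 2) p0 => x x0; field; rewrite gt_eqF.
(* Error budget: one [d] for the truncated Basel sum, two for the quadratic part of the rounding
   error and one for its linear part. *)
pose d := e / 4; have d0 : 0 < d by rewrite /d; lra.
have [r hr] : exists r : nat, pi ^+ 2 / (4 * 2 ^+ r) <= d.
  have /cvgrPdist_le/(_ (d / (pi ^+ 2 / 4))) : (fun n : nat => (1 / 2 : R) ^+ n) @ \oo --> (0 : R).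
    by apply: cvg_expr; rewrite ger0_norm; lra.
  have p4 : 0 < pi ^+ 2 / 4 :> R by lra.
  rewrite divr_gt0 // => /(_ isT)[k _ /(_ k (leqnn k))] /=.
  rewrite sub0r normrN ger0_norm ?exprn_ge0 // ler_pdivlMr // => hk; exists k.
  by rewrite invfM mulrA mulrC -exprVn -div1r.
pose T := 4 / d.
pose K := (2 ^ r)%:R ^+ 2 + T ^+ 2 / d.
have T0 : 0 < T by rewrite divr_gt0.
have K0 : 0 <= K by rewrite addr_ge0 ?sqr_ge0 // divr_ge0 ?sqr_ge0 ?(ltW d0).
exists K => n.
rewrite -/c; set S := \sum_(_ <= _ < _) _.
have n0 : 0 <= n%:R :> R by [].
have H0 : inv_sqr_sum R n <= pi ^+ 2 / 6 by exact: inv_sqr_sum_le.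
have H00 : 0 <= inv_sqr_sum R n by rewrite sumr_ge0.
have H74 := inv_sqr_sum_tail_le R n.
have Sup : S <= n%:R ^+ 2 * inv_sqr_sum R n.
  rewrite /S inv_sqr_sumE big_distrr /=; apply: ler_sum_nat => j /andP[j1 _].
  rewrite -exprVn -exprMn lerXn2r ?nnegrE //; exact: natr_divn_le.
have Slo : n%:R ^+ 2 * inv_sqr_sum R n - (d * n%:R ^+ 2 * inv_sqr_sum R n + n%:R * (4 / d)) <= S.
  have -> : n%:R * (4 / d) = \sum_(1 <= j < n.+1) (4 / d).
    by rewrite sumr_const_nat subn1 mulr_natl.
  rewrite /S inv_sqr_sumE !big_distrr /= -big_split -sumrB /=; apply: ler_sum_nat => j /andP[j1 _].
  have := @natr_divn_ge R n j j1; have := mul_le_sqr 2 (n%:R / j%:R) d0.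
  have -> : n%:R ^+ 2 * j%:R ^- 2 = (n%:R / j%:R) ^+ 2 :> R by rewrite exprMn exprVn.
  rewrite -mulrA.
  have -> : n%:R ^+ 2 * j%:R ^- 2 = (n%:R / j%:R) ^+ 2 :> R by rewrite exprMn exprVn.
  have : 0 <= (n %/ j)%N%:R :> R by [].
  have : 0 <= n%:R / j%:R :> R by [].
  move: (n%:R / j%:R) ((n %/ j)%N%:R : R) => x f x0 f0.
  have -> : 2 ^+ 2 / d = 4 / d by congr (_ / _); ring.
  move=> h1 h2; suff : x ^+ 2 - 2 * x <= f ^+ 2 by lra.
  (* If [x <= 1] the left side is nonpositive; otherwise [0 <= x - 1 <= f] can be squared. *)
  have [x1|x1] := leP x 1; nra.
(* For [n < 2 ^ r] the tail of the Basel sum need not be small, but [n^2] is then bounded and goes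
   into the constant. *)
have Hlow : n%:R ^+ 2 * (pi ^+ 2 / 6 - inv_sqr_sum R n) <=
    d * n%:R ^+ 2 + (2 ^ r)%:R ^+ 2 * (pi ^+ 2 / 6).
  have n20 : 0 <= n%:R ^+ 2 :> R by rewrite sqr_ge0.
  have [rn|nr] := leqP (2 ^ r) n.
    have h1 := inv_sqr_sum_ge R r; have h2 := inv_sqr_sum_homo R rn.
    have h3 : pi ^+ 2 / 6 - inv_sqr_sum R n <= d by lra.
    have h4 : 0 <= (2 ^ r)%:R ^+ 2 * (pi ^+ 2 / 6) :> R by rewrite mulr_ge0 ?sqr_ge0 //; lra.
    have := ler_wpM2l n20 h3; lra.
  have h3 : n%:R ^+ 2 <= (2 ^ r)%:R ^+ 2 :> R by rewrite lerXn2r ?nnegrE // ler_nat ltnW.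
  have h4 : 0 <= pi ^+ 2 / 6 :> R by lra.
  have h5 := ler_wpM2r h4 h3.
  have h6 : 0 <= d * n%:R ^+ 2 by rewrite mulr_ge0 // ltW.
  have h7 : 0 <= n%:R ^+ 2 * inv_sqr_sum R n by rewrite mulr_ge0.
  lra.
have hT := mul_le_sqr T n%:R d0.
have h1 := ler_wpM2l (ltW c0) Sup.
have h2 := ler_wpM2l (ltW c0) Slo.
have h3 := ler_wpM2l (ltW c0) Hlow.
have n20 : 0 <= n%:R ^+ 2 :> R by rewrite sqr_ge0.
have h4 : c * (n%:R ^+ 2 * inv_sqr_sum R n) <= n%:R ^+ 2 / 2.
  have := ler_wpM2l (mulr_ge0 (ltW c0) n20) H0.
  have -> : c * n%:R ^+ 2 * (pi ^+ 2 / 6) = n%:R ^+ 2 * (c * (pi ^+ 2 / 6)) by ring.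
  rewrite cE; lra.
have h5 : c * (n%:R ^+ 2 * (pi ^+ 2 / 6 - inv_sqr_sum R n)) =
    n%:R ^+ 2 * (c * (pi ^+ 2 / 6)) - c * (n%:R ^+ 2 * inv_sqr_sum R n) by ring.
have h6 : c * (d * n%:R ^+ 2 + (2 ^ r)%:R ^+ 2 * (pi ^+ 2 / 6)) =
    c * (d * n%:R ^+ 2) + (2 ^ r)%:R ^+ 2 * (c * (pi ^+ 2 / 6)) by ring.
rewrite h5 h6 cE in h3.
have dn0 : 0 <= d * n%:R ^+ 2 by rewrite mulr_ge0 // ltW.
have h7 : c * (d * n%:R ^+ 2) <= d * n%:R ^+ 2 by rewrite ler_piMl.
have h8 : c * (d * n%:R ^+ 2 * inv_sqr_sum R n + n%:R * (4 / d)) <= 2 * (d * n%:R ^+ 2) + n%:R * T.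
  have h9 : d * n%:R ^+ 2 * inv_sqr_sum R n <= d * n%:R ^+ 2 * 2.
    by rewrite ler_wpM2l //; move: H74; lra.
  have h10 : 0 <= n%:R * T by rewrite mulr_ge0 // ltW.
  have h11 : 0 <= d * n%:R ^+ 2 * inv_sqr_sum R n by rewrite mulr_ge0.
  rewrite -/T mulrDr; apply: lerD; last by rewrite ler_piMl.
  by apply: (le_trans (ler_piMl _ c1)) => //; lra.
have h9 : 0 <= (2 ^ r)%:R ^+ 2 :> R by rewrite sqr_ge0.
rewrite mulrBr in h2.
have dE : e = 4 * d by rewrite /d; field.
rewrite ler_norml dE /K; apply/andP; split; last by nra.
nra.
Qed.

(** * Growth of the product of cyclotomic values *)

Definition Phi_at (p k : nat) : int := ('Phi_k).[p%:Z].

Lemma prod_Phi_at (p n : nat) : (0 < n)%N ->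
  \prod_(d <- divisors n) Phi_at p d = p%:Z ^+ n - 1.
Proof.
move=> n0; have := congr1 (fun P : {poly int} => P.[p%:Z]) (prod_Cyclotomic n0).
by rewrite horner_prod !hornerE.
Qed.

Lemma dPhi_at (p n : nat) : (dPhi n).[p%:Z] = \prod_(1 <= k < n.+1) Phi_at p k.
Proof. by rewrite /dPhi horner_prod. Qed.

(** Strong induction: [p^k - 1] is positive, and so are its factors at the proper divisors of
    [k]. *)
Lemma Phi_at_gt0 (p k : nat) : (1 < p)%N -> (0 < k)%N -> 0 < Phi_at p k.
Proof.
move=> p1; elim/ltn_ind: k => k IH k0.
have := prod_Phi_at p k0; rewrite (bigD1_seq k) ?divisors_uniq //= -?dvdn_divisors //.
move=> E.
have : 0 < p%:Z ^+ k - 1.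
  by rewrite subr_gt0 exprn_egt1 // -lt0n.
rewrite -E pmulr_lgt0 // big_seq_cond prodr_gt0 // => d /andP[].
rewrite -dvdn_divisors // => dk dnk; apply: IH.
  by rewrite ltn_neqAle dnk dvdn_leq.
exact: dvdn_gt0 dk.
Qed.

Lemma dPhi_at_gt0 (p n : nat) : (1 < p)%N -> 0 < (dPhi n).[p%:Z].
Proof.
move=> p1; rewrite dPhi_at big_nat_cond prodr_gt0 // => i /andP[/andP[i0 _] _].
exact: Phi_at_gt0.
Qed.

(** [p^j - 1] is the product of the values at [p] of the cyclotomic polynomials indexed by the
    divisors of [j], a subproduct of [d_n(p)]. This makes [d_n(p)] a common denominator. *)
Lemma dvd_dPhi_at (p j n : nat) : (0 < j)%N -> (j <= n)%N ->
  (p%:Z ^+ j - 1 %| (dPhi n).[p%:Z])%Z.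
Proof.
move=> j0 jn; rewrite -prod_Phi_at // dPhi_at.
have -> : \prod_(d <- divisors j) Phi_at p d =
    \prod_(d <- index_iota 1 n.+1 | (d %| j)%N) Phi_at p d.
  rewrite -[RHS]big_filter; apply: perm_big; apply: uniq_perm.
  - exact: divisors_uniq.
  - by rewrite filter_uniq // iota_uniq.
  move=> d; rewrite mem_filter mem_index_iota -dvdn_divisors //.
  case dj: (d %| j)%N => //=; rewrite ltnS (leq_trans (dvdn_leq j0 dj) jn) andbT.
  by rewrite (dvdn_gt0 j0 dj).
by rewrite [X in (_ %| X)%Z](bigID (fun d => d %| j)%N) /= dvdz_mulr.
Qed.

(** Both sides sum [f d] over the pairs with [j * d <= n]. In the induction, [n %/ j] grows exactly
    when [j] divides [n.+1], and the new terms sit at the complementary divisors. *)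
Lemma sum_divn_divisors (V : zmodType) (f : nat -> V) (n : nat) :
  \sum_(1 <= j < n.+1) \sum_(1 <= d < (n %/ j).+1) f d =
  \sum_(1 <= k < n.+1) \sum_(d <- divisors k) f d.
Proof.
elim: n => [|n IH]; first by rewrite !big_geq.
rewrite [RHS]big_nat_recr //= -IH.
transitivity (\sum_(1 <= j < n.+2) (\sum_(1 <= d < (n %/ j).+1) f d +
    if (j %| n.+1)%N then f (n.+1 %/ j)%N else 0)).
  apply: eq_big_nat => j /andP[j0 _]; rewrite divnS //.
  case: (j %| n.+1)%N; last by rewrite add0n addr0.
  by rewrite add1n big_nat_recr.
rewrite big_split /=; congr (_ + _).
  by rewrite big_nat_recr //= divn_small // [X in _ + X]big_geq // addr0.
rewrite -big_mkcond -[LHS]big_filter /=.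
have -> : \sum_(j <- [seq j <- index_iota 1 n.+2 | (j %| n.+1)%N]) f (n.+1 %/ j)%N =
          \sum_(j <- divisors n.+1) f (n.+1 %/ j)%N.
  apply: perm_big; apply: uniq_perm.
  - by rewrite filter_uniq // iota_uniq.
  - exact: divisors_uniq.
  move=> d; rewrite mem_filter mem_index_iota -dvdn_divisors //.
  case dj: (d %| n.+1)%N => //=; rewrite ltnS (dvdn_leq _ dj) // andbT.
  by rewrite (dvdn_gt0 _ dj).
rewrite -(big_map (fun j => n.+1 %/ j)%N xpredT f); apply: perm_big; apply: uniq_perm.
- rewrite map_inj_in_uniq ?divisors_uniq // => a b.
  rewrite -!dvdn_divisors // => da db E.
  by rewrite -[a](mulKn _ (ltn0Sn n)) -(divnA _ da) E divnA // mulKn.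
- exact: divisors_uniq.
move=> d; rewrite -dvdn_divisors //; apply/mapP/idP => [[j]|dn].
  by rewrite -dvdn_divisors // => jn ->; apply: dvdn_div.
exists (n.+1 %/ d)%N; first by rewrite -dvdn_divisors // dvdn_div.
by rewrite divnA // mulKn.
Qed.

Lemma ln_prod (R : realType) (I : eqType) (s : seq I) (F : I -> R) :
  (forall i, i \in s -> 0 < F i) -> ln (\prod_(i <- s) F i) = \sum_(i <- s) ln (F i).
Proof.
elim: s => [|i s IH] h; first by rewrite !big_nil ln1.
rewrite !big_cons lnM ?IH // ?posrE.
- by move=> j js; apply: h; rewrite inE js orbT.
- by apply: h; rewrite inE eqxx.
rewrite big_seq_cond prodr_gt0 // => j /andP[js _].
by apply: h; rewrite inE js orbT.
Qed.

(** The counterpart of Chebyshev's function, with logarithms to base [p]. *)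
Definition psi (R : realType) (p n : nat) : R := ln ((dPhi n).[p%:Z])%:~R / ln p%:R.

Lemma psiE (R : realType) (p n : nat) : (1 < p)%N ->
  psi R p n = \sum_(1 <= k < n.+1) (ln ((Phi_at p k)%:~R) / ln p%:R).
Proof.
move=> p1; rewrite /psi dPhi_at rmorph_prod /= ln_prod ?mulr_suml // => i.
by rewrite mem_index_iota => /andP[i0 _]; rewrite ltr0z Phi_at_gt0.
Qed.

Lemma sum_psi (R : realType) (p n : nat) : (1 < p)%N ->
  \sum_(1 <= j < n.+1) psi R p (n %/ j)%N =
  \sum_(1 <= k < n.+1) (ln (p%:R ^+ k - 1) / ln p%:R).
Proof.
move=> p1.
transitivity (\sum_(1 <= j < n.+1) \sum_(1 <= k < (n %/ j).+1)
    (ln ((Phi_at p k)%:~R : R) / ln p%:R)).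
  by apply: eq_bigr => j _; rewrite psiE.
rewrite sum_divn_divisors; apply: eq_big_nat => k /andP[k0 _].
rewrite -mulr_suml -ln_prod -?rmorph_prod /= ?prod_Phi_at //.
  by rewrite rmorphB rmorphXn /= -pmulrn.
move=> d; rewrite -dvdn_divisors // => dk.
by rewrite ltr0z Phi_at_gt0 // (dvdn_gt0 k0 dk).
Qed.

Lemma ln_expB1_bounds (R : realType) (p k : nat) : (1 < p)%N -> (0 < k)%N ->
  k%:R - 1 <= (ln (p%:R ^+ k - 1) / ln p%:R : R) <= k%:R.
Proof.
move=> p1 k0.
have pR : 2 <= p%:R :> R by rewrite (ler_nat _ 2).
have pp : 0 < p%:R :> R by lra.
have lp : 0 < ln p%:R :> R by rewrite ln_gt0 // ltr1n.
case: k k0 => // k _; have e1 : 1 <= p%:R ^+ k :> R by rewrite exprn_ege1 //; lra.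
rewrite -natr1 addrK ler_pdivrMr // ler_pdivlMr //.
have E j : j%:R * ln p%:R = ln (p%:R ^+ j) :> R by rewrite lnXn // mulr_natl.
rewrite natr1 !E; rewrite exprS.
have h : p%:R ^+ k <= p%:R * p%:R ^+ k - 1 :> R by nra.
by rewrite !ler_ln ?posrE; [rewrite h /=; lra|nra|nra|lra|nra].
Qed.

(** By [p^(k-1) <= p^k - 1 <= p^k] the floor sums of [psi] are [n^2/2 + O(n)], and those of
    [3/pi^2 * n^2] agree to leading order. The Tauberian lemma applies to the difference of the two
    functions. *)
Lemma psi_asymp (R : realType) (p : nat) : (1 < p)%N ->
  forall e : R, 0 < e -> exists K : R, forall n : nat,
   `|psi R p n - 3 / pi ^+ 2 * n%:R ^+ 2| <= e * n%:R ^+ 2 + K.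
Proof.
move=> p1.
have lp : 0 < ln p%:R :> R by rewrite ln_gt0 // ltr1n.
have p8 := @pi_sqr_gt8 R.
have c0 : 0 < 3 / pi ^+ 2 :> R by rewrite divr_gt0 //; lra.
have c1 : 3 / pi ^+ 2 <= 1 :> R by rewrite ler_pdivrMr //; lra.
pose c : R := 3 / pi ^+ 2.
have psi_ge0 n : 0 <= psi R p n.
  rewrite /psi divr_ge0 ?(ltW lp) // ln_ge0 // (ler1z R) -gtz0_ge1.
  exact: dPhi_at_gt0.
have sumid n : \sum_(1 <= k < n.+1) (k%:R : R) = n%:R ^+ 2 / 2 + n%:R / 2.
  elim: n => [|n IH]; first by rewrite big_geq // expr0n !mul0r addr0.
  by rewrite big_nat_recr //= IH -natr1; field.
have hA n : n%:R ^+ 2 / 2 - n%:R / 2 <= \sum_(1 <= j < n.+1) psi R p (n %/ j)%N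
     <= n%:R ^+ 2 / 2 + n%:R / 2.
  rewrite sum_psi // -sumid; apply/andP; split.
    have -> : n%:R ^+ 2 / 2 - n%:R / 2 = \sum_(1 <= k < n.+1) (k%:R - 1) :> R.
      by rewrite sumrB sumid sumr_const_nat subn1 /=; field.
    by apply: ler_sum_nat => k /andP[k0 _]; have /andP[] := ln_expB1_bounds R p1 k0.
  by apply: ler_sum_nat => k /andP[k0 _]; have /andP[] := ln_expB1_bounds R p1 k0.
apply: (@divn_sum_little_o R (fun n => psi R p n - c * n%:R ^+ 2) 2) => //; last first.
  move=> n; have n2 : n%:R <= n%:R ^+ 2 :> R by rewrite -natrX ler_nat; nia.
  have n0 : 0 <= n%:R ^+ 2 :> R by rewrite sqr_ge0.
  (* A priori bound to start the iteration: all terms of the floor sum are nonnegative, so the term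
     [j = 1] is at most the whole. *)
  have h1 : psi R p n <= n%:R ^+ 2.
    case: n n2 n0 => [|n] n2 n0.
      by rewrite psiE // big_geq // expr0n.
    have /andP[_] := hA n.+1; rewrite big_nat_recl // divn1.
    have : 0 <= \sum_(1 <= i < n.+1) psi R p (n.+1 %/ i.+1)%N by rewrite sumr_ge0.
    lra.
  have h2 : c * n%:R ^+ 2 <= n%:R ^+ 2 by rewrite ler_piMl.
  have h3 : 0 <= c * n%:R ^+ 2 by rewrite mulr_ge0 // ltW.
  have h4 := psi_ge0 n.
  by rewrite ler_norml; apply/andP; split; lra.
move=> e e0; have e2 : 0 < e / 2 by lra.
have [K HK] := @sum_divn_sqr R _ e2.
exists (K + (1 / 2) ^+ 2 / (e / 2)) => n.
rewrite sumrB -mulr_sumr.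
have := HK n; rewrite -/c; set S := c * _ => h1.
have /andP[h2 h3] := hA n.
have h4 := mul_le_sqr (1 / 2) n%:R e2.
move: h1; rewrite !ler_norml => /andP[h5 h6]; apply/andP; split; lra.
Qed.

(** * Partial fractions *)

Definition cofactor_poly (F : fieldType) (N : nat) (x : nat -> F) (i : 'I_N.+1) : {poly F} :=
  \prod_(j < N.+1 | j != i) ((x j)%:P - 'X).

Definition nodal_poly (F : fieldType) (N : nat) (x : nat -> F) : {poly F} :=
  \prod_(j < N.+1) ((x j)%:P - 'X).

(** The numerator of [sum_i P_i x_i / (x_i - y)] over the denominator [nodal_poly]. For
    [x_i = q^-(i+1)] the fraction is the generating function [S(y)]. *)
Definition partial_numer (F : fieldType) (N : nat) (x : nat -> F) (P : {poly F}) : {poly F} :=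
  \sum_(i < N.+1) (P`_i * x i) *: cofactor_poly x i.

Section PartialFractions.
Context (F : fieldType) (N : nat) (x : nat -> F).
Hypothesis xI : injective x.

Lemma horner_cofactor (i : 'I_N.+1) (y : F) :
  (cofactor_poly x i).[y] = \prod_(j < N.+1 | j != i) (x j - y).
Proof. by rewrite horner_prod; apply: eq_bigr => j _; rewrite !hornerE. Qed.

Lemma horner_nodal (y : F) : (nodal_poly N x).[y] = \prod_(j < N.+1) (x j - y).
Proof. by rewrite horner_prod; apply: eq_bigr => j _; rewrite !hornerE. Qed.

Lemma cofactor_node_neq0 (i : 'I_N.+1) : (cofactor_poly x i).[x i] != 0.
Proof.
rewrite horner_cofactor; apply/prodf_neq0 => j ji; rewrite subr_eq0.
by apply: contraNneq ji => /xI ji; apply/eqP/val_inj.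
Qed.

Lemma horner_cofactor_neq0 (i : 'I_N.+1) (y : F) :
  (forall j, x j != y) -> (cofactor_poly x i).[y] != 0.
Proof.
move=> xy; rewrite horner_cofactor; apply/prodf_neq0 => j _.
by rewrite subr_eq0.
Qed.

Lemma size_cofactor (i : 'I_N.+1) : (size (cofactor_poly x i) <= N.+1)%N.
Proof.
apply: (leq_trans (size_prod_leq _ _)) => /=.
apply: (@leq_trans ((\sum_(j < N.+1 | j != i) 2).+1 - #|(fun j => j != i : bool)|)).
  rewrite leq_sub2r // ltnS; apply: leq_sum => j _.
  by rewrite -opprB size_polyN size_XsubC.
rewrite sum_nat_const muln2 -addnn -addSn addnK.
by rewrite (cardC1 i) card_ord.
Qed.

Lemma nodal_cofactor (i : 'I_N.+1) : nodal_poly N x = ((x i)%:P - 'X) * cofactor_poly x i.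
Proof. by rewrite /nodal_poly (bigD1 i). Qed.

Lemma size_numer (P : {poly F}) : (size (partial_numer N x P) <= N.+1)%N.
Proof.
apply: (leq_trans (size_sum _ _ _)); apply/bigmax_leqP => i _.
by apply: (leq_trans (size_scale_leq _ _)); exact: size_cofactor.
Qed.

Lemma numer_node (P : {poly F}) (k : 'I_N.+1) :
  (partial_numer N x P).[x k] = P`_k * x k * (cofactor_poly x k).[x k].
Proof.
rewrite /partial_numer horner_sum (bigD1 k) //= hornerZ big1 ?addr0 // => i ik.
by rewrite hornerZ horner_cofactor (bigD1 k) 1?eq_sym //= subrr mul0r mulr0.
Qed.

Lemma poly_eq0_nodes (f : {poly F}) : (size f <= N.+1)%N ->
  (forall k : 'I_N.+1, f.[x k] = 0) -> f = 0.
Proof.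
move=> sf fk; apply: (@roots_geq_poly_eq0 _ f [seq x (val i) | i <- enum 'I_N.+1]).
- by apply/allP => z /mapP[i _ ->]; rewrite /root fk.
- by rewrite map_inj_uniq ?enum_uniq // => i j /xI /val_inj.
- by rewrite size_map size_enum_ord.
Qed.

Lemma partial_fraction (P : {poly F}) (y : F) : (forall i, x i != y) ->
  \sum_(i < N.+1) P`_i * x i / (x i - y) = (partial_numer N x P).[y] / (nodal_poly N x).[y].
Proof.
move=> xy; rewrite /partial_numer horner_sum mulr_suml; apply: eq_bigr => i _.
rewrite hornerZ (nodal_cofactor i) hornerM !hornerE.
have h1 : x i - y != 0 by rewrite subr_eq0.
have h2 := horner_cofactor_neq0 i xy.
by field; rewrite h1 h2.
Qed.

Lemma partial_fraction_deriv (P : {poly F}) (y : F) : (forall i, x i != y) ->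
  \sum_(i < N.+1) P`_i * x i / (x i - y) ^+ 2 =
  ((partial_numer N x P)^`().[y] * (nodal_poly N x).[y]
   - (partial_numer N x P).[y] * (nodal_poly N x)^`().[y])
    / (nodal_poly N x).[y] ^+ 2.
Proof.
move=> xy; rewrite /partial_numer raddf_sum /= !horner_sum !mulr_suml -sumrB mulr_suml.
apply: eq_bigr => i _.
rewrite derivZ !hornerZ (nodal_cofactor i) derivM derivB derivC derivX !hornerE /=.
have h1 : x i - y != 0 by rewrite subr_eq0.
have h2 := horner_cofactor_neq0 i xy.
by field; rewrite h1 h2.
Qed.

End PartialFractions.

(** * Multiple little q-Jacobi polynomials *)

Definition qnode (R : realType) (q : R) (i : nat) : R := q ^- i.+1.

Definition qroots (R : realType) (q : R) (n : nat) : {poly R} :=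
  \prod_(l < n) ('X - (q ^+ l)%:P).

Section LittleQJacobi.
Context (R : realType) (q : R).
Hypothesis q01 : 0 < q < 1.

Let q0 : 0 < q. Proof. by case/andP: q01. Qed.
Let q1 : q < 1. Proof. by case/andP: q01. Qed.
Let x := qnode q.

Lemma qexp_inj : injective (GRing.exp q).
Proof. by apply: ieexprIn => //; rewrite lt_eqF. Qed.

Lemma qexp_le1 (l : nat) : q ^+ l <= 1.
Proof. by rewrite exprn_ile1 // ltW. Qed.

Lemma qnode_inj : injective x.
Proof. by move=> i j /invr_inj /qexp_inj []. Qed.

Lemma qnode_gt1 (i : nat) : 1 < x i.
Proof. by rewrite /x /qnode invf_gt1 ?exprn_gt0 // exprn_ilt1 // ltW. Qed.

Lemma qnode_gt0 (i : nat) : 0 < x i.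
Proof. exact: lt_trans ltr01 (qnode_gt1 i). Qed.

Lemma qnode_neq (i l : nat) : x i != q ^+ l.
Proof. by rewrite gt_eqF // (le_lt_trans (qexp_le1 l)) // qnode_gt1. Qed.

Lemma qnodeE (i l : nat) : q ^+ (i.+1 + l) = q ^+ l / x i.
Proof. by rewrite /x /qnode invrK exprD mulrC. Qed.

Lemma qexp_itv (k : nat) : 0 <= q ^+ k.+1 < 1.
Proof. by rewrite exprn_ge0 ?ltW //= exprn_ilt1 // ltW. Qed.

Lemma qnode_sub_neq0 (i l : nat) : x i - q ^+ l != 0.
Proof. by rewrite subr_eq0 qnode_neq. Qed.

Section Moments.
Context (N : nat) (P : {poly R}).
Hypothesis sP : (size P <= N.+1)%N.

Lemma qmoment_term (k l : nat) :
  q ^+ k * P.[q ^+ k] * q ^+ (k * l) =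
  \sum_(i < N.+1) P`_i * (q ^+ (i.+1 + l)) ^+ k.
Proof.
rewrite (horner_coef_wide _ sP) big_distrr big_distrl /=; apply: eq_bigr => i _.
rewrite -!exprM mulnDl mulSn !exprD [(k * l)%N]mulnC [(k * i)%N]mulnC; ring.
Qed.

(** Each coefficient contributes a geometric series of ratio [q^(i+1+l)], so the moment is [S(q^l)].
    The weight [k] of the next lemma turns this into [q^l S'(q^l)]. *)
Lemma cvg_qmoment (l : nat) :
  series (fun k => q ^+ k * P.[q ^+ k] * q ^+ (k * l)) @ \oo -->
  (partial_numer N x P).[q ^+ l] / (nodal_poly N x).[q ^+ l].
Proof.
rewrite -(partial_fraction N _ (fun i => qnode_neq i l)).
rewrite (_ : (fun k => _) =
    fun k => \sum_(i < N.+1) P`_i * (q ^+ (i.+1 + l)) ^+ k); last first.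
  by apply/funext => k; rewrite qmoment_term.
apply: cvg_series_sum => i.
have -> : P`_i * x i / (x i - q ^+ l) = P`_i * (1 - q ^+ (i.+1 + l))^-1.
  have h1 := qnode_sub_neq0 i l; have h2 : x i != 0 by rewrite gt_eqF // qnode_gt0.
  by rewrite qnodeE; field; rewrite h1 h2.
by apply: cvg_seriesZ; apply: cvg_geo; apply: qexp_itv.
Qed.

Lemma cvg_qmoment_log (l : nat) :
  series (fun k => k%:R * q ^+ k * P.[q ^+ k] * q ^+ (k * l)) @ \oo -->
  q ^+ l * (((partial_numer N x P)^`().[q ^+ l] * (nodal_poly N x).[q ^+ l]
     - (partial_numer N x P).[q ^+ l] * (nodal_poly N x)^`().[q ^+ l])
    / (nodal_poly N x).[q ^+ l] ^+ 2).
Proof.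
rewrite -(partial_fraction_deriv N _ (fun i => qnode_neq i l)) mulr_sumr.
rewrite (_ : (fun k => _) =
    fun k => \sum_(i < N.+1) P`_i * (k%:R * (q ^+ (i.+1 + l)) ^+ k)); last first.
  apply/funext => k; have -> : k%:R * q ^+ k * P.[q ^+ k] * q ^+ (k * l) =
      k%:R * (q ^+ k * P.[q ^+ k] * q ^+ (k * l)) by rewrite !mulrA.
  rewrite qmoment_term.
  by rewrite mulr_sumr; apply: eq_bigr => i _; rewrite mulrCA.
apply: cvg_series_sum => i.
have -> : q ^+ l * (P`_i * x i / (x i - q ^+ l) ^+ 2) =
   P`_i * (q ^+ (i.+1 + l) / (1 - q ^+ (i.+1 + l)) ^+ 2).
  have h1 := qnode_sub_neq0 i l; have h2 : x i != 0 by rewrite gt_eqF // qnode_gt0.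
  by rewrite qnodeE; field; rewrite h1 h2.
by apply: cvg_seriesZ; apply: cvg_arithgeo; apply: qexp_itv.
Qed.

Lemma nodal_qexp_neq0 (l : nat) : (nodal_poly N x).[q ^+ l] != 0.
Proof.
rewrite horner_nodal; apply/prodf_neq0 => j _; exact: qnode_sub_neq0.
Qed.

End Moments.

(** The denominator of [S] is nonzero at every [q^l]. Since [m <= n], the numerator already vanishes
    wherever [S'] is tested, so [S' = 0] there is a condition on the derivative of the numerator
    alone. *)
Lemma is_mlqJacobiP (n m : nat) (P : {poly R}) : (m <= n)%N ->
  is_mlqJacobi q n m P <->
  [/\ (size P <= (n + m).+1)%N, P`_0 = 1,
      forall l, (l < n)%N -> (partial_numer (n + m) x P).[q ^+ l] = 0
    & forall l, (l < m)%N -> (partial_numer (n + m) x P)^`().[q ^+ l] = 0].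
Proof.
move=> mn; split=> -[sP P0 h1 h2].
- have z1 l : (l < n)%N -> (partial_numer (n + m) x P).[q ^+ l] = 0.
    move=> /h1; rewrite (sum_from0E (@cvg_qmoment _ _ sP l)) => /eqP.
    rewrite mulf_eq0 invr_eq0 (negbTE (nodal_qexp_neq0 _ _)) orbF.
    by move/eqP.
  split=> //; first by rewrite -horner_coef0.
  move=> l lm; have := h2 l lm; rewrite (sum_from0E (@cvg_qmoment_log _ _ sP l)) => /eqP.
  rewrite z1 ?(leq_trans lm) // mul0r subr0 !mulf_eq0 invr_eq0 !expf_eq0 /=.
  by rewrite (negbTE (nodal_qexp_neq0 _ _)) (gt_eqF q0) !andbF !orbF => /eqP.
- split=> //; first by rewrite horner_coef0.
    by move=> l ln; rewrite (sum_from0E (@cvg_qmoment _ _ sP l)) h1 // mul0r.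
  move=> l lm; rewrite (sum_from0E (@cvg_qmoment_log _ _ sP l)) h2 // h1 ?(leq_trans lm) //.
  by rewrite !mul0r subr0 mul0r mulr0.
Qed.

Lemma horner_qroots (n : nat) (y : R) : (qroots q n).[y] = \prod_(l < n) (y - q ^+ l).
Proof. by rewrite horner_prod; apply: eq_bigr => j _; rewrite !hornerE. Qed.

Lemma qrootsE (n : nat) :
  qroots q n = \prod_(z <- [seq q ^+ (val l) | l <- enum 'I_n]) ('X - z%:P).
Proof. by rewrite big_map /qroots big_enum. Qed.

Lemma qroots_dvd (n : nat) (f : {poly R}) :
  (forall l, (l < n)%N -> f.[q ^+ l] = 0) -> exists g, f = g * qroots q n.
Proof.
move=> h; rewrite qrootsE; apply: uniq_roots_prod_XsubC.
  by apply/allP => z /mapP[i _ ->]; rewrite /root h ?eqxx ?ltn_ord.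
rewrite uniq_rootsE map_inj_uniq ?enum_uniq // => i j /qexp_inj; exact: val_inj.
Qed.

Lemma qroots_root (n l : nat) : (l < n)%N -> (qroots q n).[q ^+ l] = 0.
Proof. by move=> ln; rewrite horner_qroots (bigD1 (Ordinal ln)) //= subrr mul0r. Qed.

Lemma qroots_deriv_neq0 (n l : nat) : (l < n)%N -> (qroots q n)^`().[q ^+ l] != 0.
Proof.
move=> ln; rewrite /qroots (bigD1 (Ordinal ln)) //= derivM derivXsubC mul1r.
rewrite !hornerE subrr mul0r addr0 horner_prod; apply/prodf_neq0 => j jl.
rewrite !hornerE subr_eq0; apply: contraNneq jl => /qexp_inj lj.
by apply/eqP/val_inj.
Qed.

Lemma size_qroots (n : nat) : size (qroots q n) = n.+1.
Proof. by rewrite qrootsE size_prod_XsubC size_map size_enum_ord. Qed.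

Lemma qroots_neq0 (n : nat) : qroots q n != 0.
Proof. by rewrite -size_poly_gt0 size_qroots. Qed.

Lemma qroots_qnode_gt0 (n i : nat) : 0 < (qroots q n).[x i].
Proof.
rewrite horner_qroots prodr_gt0 // => j _.
by rewrite subr_gt0 (le_lt_trans (qexp_le1 j)) // qnode_gt1.
Qed.

(** The prescribed zeros, counted with multiplicity, exhaust the degree, so the cofactor is
    constant. *)
Lemma double_qroots (n m : nat) (f : {poly R}) : (m <= n)%N ->
  (size f <= (n + m).+1)%N ->
  (forall l, (l < n)%N -> f.[q ^+ l] = 0) ->
  (forall l, (l < m)%N -> f^`().[q ^+ l] = 0) ->
  exists k : R, f = k *: (qroots q n * qroots q m).
Proof.
move=> mn sf h1 h2; have [g fg] := qroots_dvd h1.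
have g0 l : (l < m)%N -> g.[q ^+ l] = 0.
  move=> lm; have := h2 l lm; rewrite fg derivM !hornerE.
  rewrite qroots_root ?(leq_trans lm) // mulr0 add0r => /eqP.
  by rewrite mulf_eq0 (negbTE (qroots_deriv_neq0 _)) ?orbF ?(leq_trans lm) // => /eqP.
have [h gh] := qroots_dvd g0.
exists h`_0; rewrite fg gh -mulrA [qroots q m * _]mulrC.
have [->|h0] := eqVneq h 0; first by rewrite mul0r coef0 scale0r.
rewrite -mul_polyC; congr (_ * _); apply: size1_polyC.
have : size f = (size h + m + n)%N.
  rewrite fg gh size_mul ?mulf_neq0 ?qroots_neq0 // size_mul ?qroots_neq0 // !size_qroots.
  by rewrite !addnS.
by move: sf => /[swap] ->; lia.
Qed.

(* [jacobi_const] normalizes the coefficient at [0] to [1]. *)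
Definition jacobi_const (n m : nat) : R :=
  x 0 * (cofactor_poly x (ord0 : 'I_(n + m).+1)).[x 0]
  / ((qroots q n).[x 0] * (qroots q m).[x 0]).

(** At the node [x 0] only the cofactor belonging to [P_0 = 1] survives, which fixes the
    constant. *)
Lemma numer_mlqJacobi (n m : nat) (P : {poly R}) : (m <= n)%N ->
  is_mlqJacobi q n m P ->
  partial_numer (n + m) x P = jacobi_const n m *: (qroots q n * qroots q m).
Proof.
move=> mn /(is_mlqJacobiP _ mn) [sP P0 h1 h2].
have [k E] := double_qroots mn (size_numer _ _ _) h1 h2.
rewrite E; congr (_ *: _); rewrite /jacobi_const.
have := numer_node x P (ord0 : 'I_(n + m).+1); rewrite E P0 mul1r hornerZ hornerM /= => <-.
by rewrite mulfK // mulf_neq0 // gt_eqF // qroots_qnode_gt0.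
Qed.

(** The values of the numerator at the [N + 1] nodes prescribe the coefficients. The resulting
    numerator then agrees with the wanted one at all nodes, hence identically by degree. *)
Lemma mlqJacobi_exists (n m : nat) : (m <= n)%N -> exists P, is_mlqJacobi q n m P.
Proof.
move=> mn; pose N := (n + m)%N.
pose A := qroots q n * qroots q m.
pose c (i : 'I_N.+1) : R := jacobi_const n m * A.[x i] / (x i * (cofactor_poly x i).[x i]).
pose P : {poly R} := \poly_(i < N.+1) c (inord i).
have xn0 i : x i != 0 by rewrite gt_eqF // qnode_gt0.
have cn0 (i : 'I_N.+1) := cofactor_node_neq0 qnode_inj i.
have E : partial_numer N x P = jacobi_const n m *: A.
  apply/eqP; rewrite -subr_eq0; apply/eqP; apply: (poly_eq0_nodes qnode_inj (N := N)).
    apply: (leq_trans (size_polyD _ _)); rewrite geq_max size_numer size_polyN.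
    apply: (leq_trans (size_scale_leq _ _)).
    by rewrite size_mul ?qroots_neq0 // !size_qroots addnS.
  move=> k; rewrite hornerD hornerN numer_node hornerZ coef_poly ltn_ord inord_val /c.
  rewrite -mulrA divfK ?subrr //; last exact: mulf_neq0.
exists P; apply/is_mlqJacobiP => //; split.
- exact: size_poly.
- rewrite coef_poly /= /c (_ : inord 0 = ord0); last by apply/val_inj; rewrite /= inordK.
  rewrite /jacobi_const /A hornerM /= divfK ?divff //.
    by rewrite mulf_neq0 // cn0.
  by rewrite mulf_neq0 // gt_eqF // qroots_qnode_gt0.
- by move=> l ln; rewrite E hornerZ hornerM qroots_root // mul0r mulr0.
- move=> l lm; rewrite E derivZ hornerZ derivM hornerD !hornerM !qroots_root //.
    by rewrite !(mulr0, mul0r) addr0 mulr0.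
  exact: leq_trans mn.
Qed.

(** Existence rules out the default value [0] of [xget]. *)
Lemma mlqJacobi_spec (n m : nat) : (m <= n)%N ->
  is_mlqJacobi q n m (mlqJacobi q n m).
Proof. by move=> mn; have := xgetPex 0 (mlqJacobi_exists mn). Qed.

Lemma size_mlqJacobi (n m : nat) : (m <= n)%N ->
  (size (mlqJacobi q n m) <= (n + m).+1)%N.
Proof. by move=> /mlqJacobi_spec []. Qed.

Lemma coef_mlqJacobi (n m : nat) (i : 'I_(n + m).+1) : (m <= n)%N ->
  (mlqJacobi q n m)`_i =
  jacobi_const n m * (qroots q n).[x i] * (qroots q m).[x i] / (x i * (cofactor_poly x i).[x i]).
Proof.
move=> mn; have := numer_node x (mlqJacobi q n m) i.
rewrite (numer_mlqJacobi mn (mlqJacobi_spec mn)) hornerZ hornerM mulrA => ->.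
rewrite -mulrA mulfK // mulf_neq0 ?cofactor_node_neq0 //; last exact: qnode_inj.
by rewrite gt_eqF // qnode_gt0.
Qed.

End LittleQJacobi.

(** * Integrality *)

Section DividedDifference.
Context (R : realType) (N : nat) (y : nat -> int).
Hypothesis yI : injective y.

Let yR (i : nat) : R := (y i)%:~R.

Let yRI : injective yR.
Proof. by move=> i j /intr_inj /yI. Qed.

Let card_neq (i : 'I_N.+1) : #|(fun j : 'I_N.+1 => j != i)| = N.
Proof. by have := cardC1 i; rewrite card_ord /= => E; rewrite -[RHS]E; apply: eq_card. Qed.

Lemma coef_cofactor (i : 'I_N.+1) : (cofactor_poly yR i)`_N = (-1) ^+ N.
Proof.
have -> : cofactor_poly yR i = ((-1) ^+ N)%:P * \prod_(j < N.+1 | j != i) ('X - (yR j)%:P).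
  rewrite /cofactor_poly (eq_bigr (fun j : 'I_N.+1 => (-1)%:P * ('X - (yR j)%:P))); last first.
    by move=> j _; rewrite polyCN mulN1r opprB.
  by rewrite big_split /= prodr_const polyC_exp card_neq.
set g := \prod_(_ < _ | _) _.
have gm : g \is monic by apply: monic_prod => j _; apply: monicXsubC.
have sg : size g = N.+1.
  rewrite /g -big_filter -(big_map (fun j : 'I_N.+1 => yR j) xpredT (fun z => 'X - z%:P)).
  rewrite size_prod_XsubC size_map -sum1_size big_filter.
  by rewrite sum1_card card_neq.
rewrite coefCM; have /monicP := gm; rewrite /lead_coef sg /= => ->.
by rewrite mulr1.
Qed.

(** Lagrange interpolation reproduces [r]; compare the coefficients of ['X ^+ N]. Up to sign the
    left side is the divided difference of [r] at all nodes. *)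
Lemma lagrange_lead (r : {poly R}) : (size r <= N.+1)%N ->
  \sum_(i < N.+1) r.[yR i] / (cofactor_poly yR i).[yR i] = (-1) ^+ N * r`_N.
Proof.
move=> sr; pose f := \sum_(i < N.+1) (r.[yR i] / (cofactor_poly yR i).[yR i]) *: cofactor_poly yR i.
have rE : r = f.
  apply/eqP; rewrite -subr_eq0; apply/eqP; apply: (poly_eq0_nodes yRI (N := N)).
    apply: (leq_trans (size_polyD _ _)); rewrite geq_max sr size_polyN.
    apply: (leq_trans (size_sum _ _ _)); apply/bigmax_leqP => i _.
    by apply: (leq_trans (size_scale_leq _ _)); exact: size_cofactor.
  move=> k; rewrite hornerD hornerN /f horner_sum (bigD1 k) //= hornerZ.
  rewrite divfK ?(cofactor_node_neq0 yRI) // big1 ?addr0 ?subrr // => i ik.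
  by rewrite hornerZ [X in _ * X]horner_cofactor (bigD1 k) 1?eq_sym //= subrr mul0r mulr0.
rewrite [in RHS]rE coef_sum mulr_sumr; apply: eq_bigr => i _.
by rewrite coefZ coef_cofactor mulrCA -expr2 -exprM mulnC exprM sqrrN !expr1n mulr1.
Qed.

(** Only values at the nodes matter, so [g] may be reduced modulo the monic polynomial [w]. The
    remainder keeps integer coefficients and has degree at most [N], so [lagrange_lead] applies. *)
Lemma divided_difference_int (g : {poly int}) :
  \sum_(i < N.+1) (map_poly intr g).[yR i] / (cofactor_poly yR i).[yR i] \is a Num.int.
Proof.
pose w := \prod_(j < N.+1) ('X - (y j)%:P).
have wm : w \is monic by apply: monic_prod => j _; apply: monicXsubC.
have sw : size w = N.+2 by rewrite /w size_prod_XsubC /index_enum -enumT size_enum_ord.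
pose r := Pdiv.Ring.rmodp g w.
have sr : (size r <= N.+1)%N.
  by rewrite -ltnS -sw Pdiv.Ring.ltn_rmodp monic_neq0.
have E : g = Pdiv.Ring.rdivp g w * w + r by apply: Pdiv.RingMonic.rdivp_eq.
have gr (i : 'I_N.+1) : (map_poly intr g).[yR i] = (map_poly intr r).[yR i] :> R.
  rewrite !horner_map /= E hornerD hornerM.
  have -> : w.[y i] = 0 by rewrite horner_prod (bigD1 i) //= !hornerE subrr mul0r.
  by rewrite mulr0 add0r.
rewrite (eq_bigr (fun i : 'I_N.+1 =>
    (map_poly intr r).[yR i] / (cofactor_poly yR i).[yR i])); last first.
  by move=> i _; rewrite gr.
rewrite lagrange_lead ?(leq_trans (size_poly _ _)) //.
rewrite rpredM //; first by rewrite rpredX // rpredN rpred1.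
by rewrite coef_map /= intr_int.
Qed.
End DividedDifference.

(** The ratios [pprod (a + b) / (pprod a * pprod b)] are the Gaussian binomials in base [p]. *)
Definition pprod (R : realType) (p k : nat) : R := \prod_(j < k) (p%:R ^+ j.+1 - 1).

Section Coefficients.
Context (R : realType) (p : nat).
Hypothesis p1 : (1 < p)%N.

Let pR : R := p%:R.
Let q : R := pR^-1.
Let P1 : 1 < pR. Proof. by rewrite ltr1n. Qed.
Let P0 : 0 < pR. Proof. exact: lt_trans ltr01 P1. Qed.
Let Pn0 : pR != 0. Proof. by rewrite gt_eqF. Qed.

Lemma inv_nat01 : 0 < q < 1.
Proof. by rewrite invr_gt0 P0 invf_lt1. Qed.

Lemma qnode_nat (i : nat) : qnode q i = pR ^+ i.+1.
Proof. by rewrite /qnode /q -exprVn invrK. Qed.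

Lemma expB1_gt0 (j : nat) : 0 < pR ^+ j.+1 - 1.
Proof. by rewrite subr_gt0 exprn_egt1. Qed.

Lemma pprod_gt0 (k : nat) : 0 < pprod R p k.
Proof. by rewrite prodr_gt0 // => j _; apply: expB1_gt0. Qed.

Lemma pprod_neq0 (k : nat) : pprod R p k != 0.
Proof. by rewrite gt_eqF // pprod_gt0. Qed.

Lemma pprodS (k : nat) : pprod R p k.+1 = pprod R p k * (pR ^+ k.+1 - 1).
Proof. by rewrite /pprod big_ord_recr. Qed.

Lemma pprod0 : pprod R p 0 = 1.
Proof. by rewrite /pprod big_ord0. Qed.

(** Double induction by the Pascal rule for Gaussian binomials. *)
Lemma gauss_int (a b : nat) :
  pprod R p (a + b) / (pprod R p a * pprod R p b) \is a Num.int.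
Proof.
elim: b a => [|b IHb] a.
  by rewrite addn0 pprod0 mulr1 divff ?pprod_neq0.
elim: a => [|a IHa].
  by rewrite add0n pprod0 mul1r divff ?pprod_neq0.
have -> : pprod R p (a.+1 + b.+1) / (pprod R p a.+1 * pprod R p b.+1) =
   pprod R p (a.+1 + b) / (pprod R p a.+1 * pprod R p b)
   + pR ^+ b.+1 * (pprod R p (a + b.+1) / (pprod R p a * pprod R p b.+1)).
  have -> : (a.+1 + b.+1 = (a + b).+2)%N by lia.
  have -> : (a.+1 + b = (a + b).+1)%N by lia.
  have -> : (a + b.+1 = (a + b).+1)%N by lia.
  rewrite [pprod _ _ (a + b).+2]pprodS [pprod _ _ a.+1]pprodS [pprod _ _ b.+1]pprodS.
  have h1 := pprod_neq0 a; have h2 := pprod_neq0 b.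
  have h3 : pR ^+ a.+1 - 1 != 0 by rewrite gt_eqF // expB1_gt0.
  have h4 : pR ^+ b.+1 - 1 != 0 by rewrite gt_eqF // expB1_gt0.
  have -> : pR ^+ (a + b).+2 = pR ^+ a.+1 * pR ^+ b.+1.
    by rewrite -exprD; congr (_ ^+ _); lia.
  move: (pprod R p (a + b).+1) (pprod R p a) (pprod R p b) (pR ^+ a.+1) (pR ^+ b.+1) h1 h2 h3 h4.
  by move=> s u v w z h1 h2 h3 h4; field; rewrite h1 h2 h3 h4.
by rewrite rpredD // rpredM // rpredX // rpred_nat.
Qed.

Lemma qroots_qnode (n i : nat) :
  (qroots q n).[qnode q i] = (\prod_(l < n) q ^+ l) * (pprod R p (n + i) / pprod R p i).
Proof.
rewrite horner_qroots; elim: n => [|n IH].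
  by rewrite !big_ord0 mul1r divff ?pprod_neq0.
rewrite !big_ord_recr /= IH addSn pprodS.
have -> : qnode q i - q ^+ n = q ^+ n * (pR ^+ (n + i).+1 - 1).
  rewrite qnode_nat mulrBr mulr1 -addnS exprD mulrA -exprMn.
  by rewrite mulVf // expr1n mul1r.
by rewrite mulrACA; congr (_ * _); rewrite mulrAC.
Qed.

Lemma cofactor_qnode (N : nat) (i : 'I_N.+1) :
  (cofactor_poly (qnode q) i).[qnode q i] =
  (-1) ^+ i * (\prod_(j < i) pR ^+ j.+1) * pprod R p i
   * (pR ^+ (i.+1 * (N - i)) * pprod R p (N - i)).
Proof.
rewrite horner_cofactor.
rewrite -(big_mkord (fun j => j != i) (fun j => qnode q j - qnode q i)).
rewrite (@big_cat_nat _ _ _ i) //=; last by rewrite ltnW // ltn_ord.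
congr (_ * _).
  rewrite big_mkord.
  transitivity (\prod_(j < i) (-1 * (pR ^+ j.+1 * (pR ^+ (i - j) - 1)))).
    apply: eq_big => j; first by rewrite neq_ltn ltn_ord.
    move=> _; rewrite !qnode_nat mulrBr -exprD addSn subnKC ?mulr1; last first.
      by rewrite ltnW.
    by rewrite mulN1r opprB.
  rewrite !big_split /= prodr_const card_ord mulrA; congr (_ * _).
  rewrite /pprod (reindex_inj rev_ord_inj) /=; apply: eq_bigr => j _.
  by congr (_ ^+ _ - _); have := ltn_ord j; lia.
rewrite big_ltn_cond ?ltn_ord //= eqxx /=.
have -> : \prod_(i.+1 <= j < N.+1 | j != i) (qnode q j - qnode q i) =
    \prod_(i.+1 <= j < N.+1) (qnode q j - qnode q i).
  rewrite big_nat_cond [RHS]big_nat_cond; apply: eq_bigl => j.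
  by case: ltngtP => //=; rewrite ?andbF.
rewrite -{1}[i.+1]add0n big_addn subSS big_mkord.
transitivity (\prod_(j < N - i) (pR ^+ i.+1 * (pR ^+ j.+1 - 1))).
  apply: eq_bigr => j _; rewrite !qnode_nat mulrBr mulr1 -exprD.
  by congr (_ ^+ _ - _); lia.
by rewrite big_split /= prodr_const card_ord -exprM.
Qed.

Lemma cofactor_qnode0 (N : nat) :
  (cofactor_poly (qnode q) (ord0 : 'I_N.+1)).[qnode q 0] = pR ^+ N * pprod R p N.
Proof.
have := cofactor_qnode (ord0 : 'I_N.+1).
by rewrite /= big_ord0 expr0 pprod0 !mul1r subn0 mul1n.
Qed.

(** The exponents on the right are [i(i+1)/2] and [i(i-1)/2], kept as products to avoid halves. The
    first cancels against the cofactor, the second stays as an integer factor. *)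
Lemma prod_pow_split (i : nat) :
  pR ^+ (i * i) = (\prod_(j < i) pR ^+ j.+1) * \prod_(j < i) pR ^+ (i.-1 - j).
Proof.
rewrite -big_split /= (eq_bigr (fun=> pR ^+ i)) ?prodr_const ?card_ord ?exprM // => j _.
by rewrite -exprD; congr (_ ^+ _); have := ltn_ord j; lia.
Qed.

(* With [z = p ^ N], each term [c_i z ^ i] is an integer power of [p] times
   three Gaussian binomials. *)
Lemma coef_mlqJacobi_int (n m : nat) (i : 'I_(n + m).+1) : (m <= n)%N ->
  (mlqJacobi q n m)`_i * (pR ^+ (n + m)) ^+ i \is a Num.int.
Proof.
move=> mn; rewrite (coef_mlqJacobi inv_nat01) // /jacobi_const cofactor_qnode0 cofactor_qnode.
rewrite !qroots_qnode !addn0 pprod0 !divr1 !qnode_nat expr1.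
set N := (n + m)%N; set s := (-1) ^+ i.
have iN : (i <= N)%N by rewrite -ltnS ltn_ord.
(* The powers of [p] in the normalization and in [z ^ i] cover those in the denominator and leave
   exactly the second product. *)
have E : pR * pR ^+ N * (pR ^+ N) ^+ i =
    pR ^+ i.+1 * pR ^+ (i.+1 * (N - i)) *
    ((\prod_(j < i) pR ^+ j.+1) * \prod_(j < i) pR ^+ (i.-1 - j)).
  rewrite -prod_pow_split -exprM -exprS -!exprD; congr (_ ^+ _).
  rewrite mulSn -[in LHS](subnK iN); move: (N - i)%N => k; nia.
have A1 := gauss_int n i; have A2 := gauss_int m i; have A3 := gauss_int (N - i) i.
rewrite subnK // in A3.
set Qn := \prod_(l < n) q ^+ l; set Qm := \prod_(l < m) q ^+ l.
have Qn0 : Qn != 0 by apply/prodf_neq0 => l _; rewrite expf_neq0 // invr_neq0.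
have Qm0 : Qm != 0 by apply/prodf_neq0 => l _; rewrite expf_neq0 // invr_neq0.
have s0 : s != 0 by rewrite expf_neq0 // oppr_eq0 oner_neq0.
have sV : s^-1 = s by rewrite /s -exprVn invrN1.
set T := \prod_(j < i) pR ^+ (i.-1 - j) in E *.
set U := \prod_(j < i) pR ^+ j.+1 in E *.
have U0 : U != 0 by apply/prodf_neq0 => l _; rewrite expf_neq0.
have TI : T \is a Num.int by rewrite rpred_prod // => j _; rewrite rpredX // rpred_nat.
suff -> : pR * (pR ^+ N * pprod R p N) / (Qn * pprod R p n * (Qm * pprod R p m)) *
  (Qn * (pprod R p (n + i) / pprod R p i)) * (Qm * (pprod R p (m + i) / pprod R p i)) /
  (pR ^+ i.+1 * (s * U * pprod R p i * (pR ^+ (i.+1 * (N - i)) * pprod R p (N - i)))) *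
  (pR ^+ N) ^+ i =
  s * T * (pprod R p (n + i) / (pprod R p n * pprod R p i)) *
  (pprod R p (m + i) / (pprod R p m * pprod R p i)) *
  (pprod R p N / (pprod R p (N - i) * pprod R p i)).
  do 4 (apply: rpredM => //).
  by rewrite /s rpredX // rpredN rpred1.
have h1 := pprod_neq0 n; have h2 := pprod_neq0 m; have h3 := pprod_neq0 i.
have h4 := pprod_neq0 (N - i).
have h5 : pR ^+ i.+1 != 0 by rewrite expf_neq0.
have h6 : pR ^+ (i.+1 * (N - i)) != 0 by rewrite expf_neq0.
transitivity ((pR * pR ^+ N * (pR ^+ N) ^+ i) * pprod R p N * pprod R p (n + i) *
   pprod R p (m + i) / (pprod R p n * pprod R p m * pprod R p i * pprod R p i *
   pR ^+ i.+1 * (s * U * pprod R p i * (pR ^+ (i.+1 * (N - i)) * pprod R p (N - i))))).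
  move: (pprod R p N) (pprod R p (n + i)) (pprod R p (m + i)) (pR ^+ i.+1)
    (pR ^+ (i.+1 * (N - i))) ((pR ^+ N) ^+ i) (pR ^+ N) h5 h6
    (pprod R p n) (pprod R p m) (pprod R p i) (pprod R p (N - i)) h1 h2 h3 h4.
  move=> a1 a2 a3 a4 a5 a6 a7 h5 h6 a8 a9 a10 a11 h1 h2 h3 h4.
  by field; rewrite Qn0 Qm0 s0 U0 h1 h2 h3 h4 h5 h6.
rewrite E -{2}sV.
move: (pprod R p N) (pprod R p (n + i)) (pprod R p (m + i)) (pR ^+ i.+1)
    (pR ^+ (i.+1 * (N - i))) h5 h6
    (pprod R p n) (pprod R p m) (pprod R p i) (pprod R p (N - i)) h1 h2 h3 h4.
move=> a1 a2 a3 a4 a5 h5 h6 a8 a9 a10 a11 h1 h2 h3 h4.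
by field; rewrite s0 U0 h1 h2 h3 h4 h5 h6.
Qed.

Lemma horner_mlqJacobi_top_int (n m : nat) : (m <= n)%N ->
  (mlqJacobi q n m).[pR ^+ (n + m)] \is a Num.int.
Proof.
move=> mn; rewrite (horner_coef_wide _ (size_mlqJacobi inv_nat01 mn)).
by rewrite rpred_sum // => i _; apply: coef_mlqJacobi_int.
Qed.

End Coefficients.

Lemma int_of_coprime (R : realType) (a : R) (u v : int) : coprimez u v ->
  a * u%:~R \is a Num.int -> a * v%:~R \is a Num.int -> a \is a Num.int.
Proof.
move=> /coprimezP[[s t] /= E] hu hv.
have -> : a = s%:~R * (a * u%:~R) + t%:~R * (a * v%:~R).
  by rewrite mulrCA [t%:~R * _]mulrCA -mulrDr -!intrM -intrD E mulr1.
by apply: rpredD; apply: rpredM => //; apply: intr_int.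
Qed.

Lemma coprimez_expB1 (p j : nat) : coprimez p%:Z (p%:Z ^+ j.+1 - 1).
Proof.
apply/coprimezP; exists (p%:Z ^+ j, -1) => /=.
by rewrite mulN1r opprB -exprSr addrC subrK.
Qed.

Lemma coprimez_prod_expB1 (p k : nat) :
  coprimez p%:Z (\prod_(j < k) (p%:Z ^+ j.+1 - 1)).
Proof.
elim/big_ind: _ => [|u v hu hv|i _]; first by rewrite /coprimez gcdz1.
- by rewrite coprimezMr hu.
- exact: coprimez_expB1.
Qed.

Section Integrality.
Context (R : realType) (p : nat).
Hypothesis p1 : (1 < p)%N.

Let pR : R := p%:R.
Let q : R := pR^-1.
Let P1 : 1 < pR. Proof. by rewrite ltr1n. Qed.
Let P0 : 0 < pR. Proof. exact: lt_trans ltr01 P1. Qed.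
Let Pn0 : pR != 0. Proof. by rewrite gt_eqF. Qed.

Lemma qroots_scaled (n : nat) (y : R) :
  (qroots q n).[y] = (\prod_(l < n) q ^+ l) * \prod_(l < n) (pR ^+ l * y - 1).
Proof.
rewrite horner_qroots -big_split /=; apply: eq_bigr => l _.
by rewrite mulrBr mulrA -exprMn mulVf // expr1n mul1r mulr1.
Qed.

(* The orthogonality relations make this integral although the single
   coefficients have powers of [p] in their denominators: the sum is a divided
   difference of an integer polynomial. *)
Lemma horner_mlqJacobi_pow_int (n m t : nat) : (m <= n)%N -> (0 < t <= n + m)%N ->
  (mlqJacobi q n m).[pR ^+ t] \is a Num.int.
Proof.
move=> mn /andP[t0 tN]; set N := (n + m)%N in tN *; set a := _.[_].
have aE : a = \sum_(i < N.+1) (mlqJacobi q n m)`_i * (pR ^+ t) ^+ i.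
  by rewrite -(horner_coef_wide _ (size_mlqJacobi (inv_nat01 R p1) mn)).
(* Two coprime multiples of [a] are integers: one by a power of [p], since the coefficients are
   integral after scaling by [p ^ N], the other by factors [p^j - 1], through the divided
   difference. *)
apply: (@int_of_coprime _ _ (p%:Z ^+ (N * N))
   ((\prod_(j < n) (p%:Z ^+ j.+1 - 1)) * (\prod_(j < m) (p%:Z ^+ j.+1 - 1)))).
- by apply: coprimezXl; rewrite coprimezMr !coprimez_prod_expB1.
- rewrite rmorphXn /= -/pR aE mulr_suml rpred_sum // => i _.
  have iN : (i <= N)%N by rewrite -ltnS ltn_ord.
  have -> : (mlqJacobi q n m)`_i * (pR ^+ t) ^+ i * pR ^+ (N * N) =
    ((mlqJacobi q n m)`_i * (pR ^+ N) ^+ i) * (pR ^+ (t * i) * pR ^+ (N * (N - i))).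
    rewrite -!mulrA; congr (_ * _); rewrite -!exprM -!exprD; congr (_ ^+ _).
    have : (N * i <= N * N)%N by rewrite leq_mul2l iN orbT.
    by rewrite mulnBr; lia.
  by apply: rpredM; [exact: coef_mlqJacobi_int | rewrite -exprD rpredX // rpred_nat].
have ppE k : (\prod_(j < k) (p%:Z ^+ j.+1 - 1))%:~R = pprod R p k.
  rewrite rmorph_prod /=; apply: eq_bigr => j _.
  by rewrite rmorphB rmorphXn.
rewrite rmorphM /= !ppE.
pose Gn (k : nat) : {poly int} := \prod_(l < k) ((p%:Z ^+ l)%:P * 'X - 1).
(* Up to a constant, [(p^t)^i] is the [t]-th power of the node. One of these factors cancels the
   node in the denominator of the coefficient, hence the exponent [t.-1] and the need for
   [0 < t]. *)
pose G := Gn n * Gn m * 'X ^+ t.-1.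
pose y (i : nat) : int := p%:Z ^+ i.+1.
have yI : injective y.
  have I : injective (GRing.exp p%:Z).
    by apply: ieexprIn; [rewrite ltz_nat ltnW | rewrite eqz_nat gtn_eqF].
  by move=> i j /I[].
have yE : (fun i => (y i)%:~R) = qnode q.
  by apply/funext => i; rewrite qnode_nat /y rmorphXn.
have GnE k x : (map_poly intr (Gn k)).[x] = \prod_(l < k) (pR ^+ l * x - 1) :> R.
  rewrite /Gn rmorph_prod horner_prod; apply: eq_bigr => l _.
  rewrite rmorphB rmorphM /= map_polyC map_polyX rmorph1 !hornerE.
  by rewrite /= rmorphXn.
have H : \sum_(i < N.+1) (map_poly intr G).[qnode q i] / (cofactor_poly (qnode q) i).[qnode q i]
    \is a Num.int by rewrite -yE; exact: divided_difference_int yI G.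
suff -> : a * (pprod R p n * pprod R p m) = pR ^+ (N.+1 - t) * pprod R p N *
   \sum_(i < N.+1) (map_poly intr G).[qnode q i] / (cofactor_poly (qnode q) i).[qnode q i].
  have HN : pprod R p N \is a Num.int by rewrite -ppE intr_int.
  have HX : pR ^+ (N.+1 - t) \is a Num.int by rewrite rpredX // rpred_nat.
  exact: (rpredM (rpredM HX HN) H).
rewrite aE mulr_suml mulr_sumr; apply: eq_bigr => i _.
rewrite (coef_mlqJacobi (inv_nat01 R p1)) // /jacobi_const cofactor_qnode0 //.
rewrite /G !rmorphM rmorphXn /= map_polyX !hornerM hornerXn !GnE.
rewrite [(qroots q n).[qnode q 0]]qroots_qnode // [(qroots q m).[qnode q 0]]qroots_qnode //.
rewrite !addn0 pprod0 !divr1.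
rewrite [(qroots q n).[_]]qroots_scaled [(qroots q m).[_]]qroots_scaled.
have c0 : (cofactor_poly (qnode q) i).[qnode q i] != 0.
  by apply: cofactor_node_neq0; apply: qnode_inj; apply: inv_nat01.
have E : pR ^+ (N.+1 - t) * qnode q i ^+ t.-1 * qnode q i = pR * pR ^+ N * (pR ^+ t) ^+ i.
  rewrite -mulrA -exprSr prednK // qnode_nat -!exprM -exprS -!exprD; congr (_ ^+ _).
  by rewrite mulSn; lia.
have Q0 k : \prod_(l < k) q ^+ l != 0.
  by apply/prodf_neq0 => l _; rewrite expf_neq0 // invr_neq0.
have x0 : qnode q i != 0 by rewrite qnode_nat expf_neq0.
move: (Q0 n) (Q0 m) (pprod_neq0 R p1 n) (pprod_neq0 R p1 m) c0 x0 E.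
move: (pprod R p n) (pprod R p m) (pprod R p N) (\prod_(l < n) q ^+ l)
  (\prod_(l < m) q ^+ l) (qnode q i) ((cofactor_poly (qnode q) i).[_]) ((pR ^+ t) ^+ i)
  (pR ^+ (N.+1 - t)) => a1 a2 a3 a4 a5 a6 a7 a8 a9 h4 h5 h1 h2 h7 h6 E.
set b1 := \prod_(l < n) _; set b2 := \prod_(l < m) _.
rewrite qnode_nat expr1 -/pR -/N.
transitivity ((pR * pR ^+ N * a8) * a3 * b1 * b2 / (a6 * a7)).
  move: (pR ^+ N) => a10.
  by field; rewrite h1 h2 h4 h5 h6 h7.
by rewrite -E; field; rewrite h6 h7.
Qed.
End Integrality.

(** * Closed forms for the values of [q_(n,n-1)] and [r_(n,n-1)] *)

Section DividedDifferenceSeries.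
Context (R : realType) (q z : R) (N : nat) (P : {poly R}).
Hypothesis q01 : 0 < q < 1.
Hypothesis z1 : 1 < z.
Hypothesis sP : (size P <= N.+1)%N.

Let zq (l : nat) : z - q ^+ l != 0.
Proof. by rewrite subr_eq0 gt_eqF // (le_lt_trans (qexp_le1 q01 l)). Qed.

(** Factoring [z^i - y^i] at [y = q^l] leaves terms that are geometric in [l]. *)
Lemma divided_difference_term (l : nat) :
  (P.[z] - P.[q ^+ l]) / (z - q ^+ l) * q ^+ l =
  \sum_(i < N.+1) \sum_(j < i) P`_i * z ^+ (i.-1 - j) * (q ^+ j.+1) ^+ l.
Proof.
rewrite !(horner_coef_wide _ sP) -sumrB !mulr_suml; apply: eq_bigr => i _.
rewrite -mulrBr subrXX mulrCA [X in X * _]mulrC mulKf ?zq // mulr_sumr mulr_suml.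
apply: eq_bigr => j _; rewrite -!mulrA; congr (_ * (_ * _)).
by rewrite -!exprM -exprD mulSn mulnC addnC [(j * l)%N]mulnC.
Qed.

Lemma cvg_divided_difference :
  series (fun l => (P.[z] - P.[q ^+ l]) / (z - q ^+ l) * q ^+ l) @ \oo -->
  \sum_(i < N.+1) \sum_(j < i) P`_i * z ^+ (i.-1 - j) / (1 - q ^+ j.+1).
Proof.
rewrite (_ : (fun l => _) = fun l =>
    \sum_(i < N.+1) \sum_(j < i) P`_i * z ^+ (i.-1 - j) * (q ^+ j.+1) ^+ l); last first.
  by apply/funext => l; rewrite divided_difference_term.
apply: cvg_series_sum => i; apply: cvg_series_sum => j.
by apply: cvg_seriesZ; apply: cvg_geo; apply: qexp_itv.
Qed.

Lemma cvg_divided_difference_log :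
  series (fun l => (P.[z] - P.[q ^+ l]) / (z - q ^+ l) * l%:R * q ^+ l) @ \oo -->
  \sum_(i < N.+1) \sum_(j < i) P`_i * z ^+ (i.-1 - j) * (q ^+ j.+1 / (1 - q ^+ j.+1) ^+ 2).
Proof.
rewrite (_ : (fun l => _) = fun l =>
    \sum_(i < N.+1) \sum_(j < i) P`_i * z ^+ (i.-1 - j) * (l%:R * (q ^+ j.+1) ^+ l)); last first.
  apply/funext => l; rewrite mulrAC divided_difference_term mulr_suml.
  apply: eq_bigr => i _; rewrite mulr_suml; apply: eq_bigr => j _.
  by rewrite -!mulrA; congr (_ * (_ * _)); rewrite mulrC.
apply: cvg_series_sum => i; apply: cvg_series_sum => j.
by apply: cvg_seriesZ; apply: cvg_arithgeo; apply: qexp_itv.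
Qed.

End DividedDifferenceSeries.

(** The cut-off [M] is free. Later [w = p^(j+1)], and [M] is such that [w^(M+1)] completes
    [z^(i-1-j)] to [z^i], while the finite sum reassembles into values of [P] at powers of [p]. *)
Lemma geo_sum_inv (F : fieldType) (w : F) (M : nat) : w != 0 -> w != 1 ->
  (1 - w^-1)^-1 = w ^+ M.+1 / (w - 1) - \sum_(t < M) w ^+ t.+1.
Proof.
move=> w0 w1; have w1' : w - 1 != 0 by rewrite subr_eq0.
elim: M => [|M IH]; first by rewrite big_ord0 subr0 expr1; field; rewrite w0 w1'.
rewrite big_ord_recr /= IH (exprS _ M.+1); move: (w ^+ M.+1) (\sum_(_ < _) _) => a b.
by field.
Qed.

Lemma arithgeo_sum_inv (F : fieldType) (w : F) (M : nat) : w != 0 -> w != 1 ->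
  w^-1 / (1 - w^-1) ^+ 2 =
  w ^+ M.+1 * ((w - 1) ^- 2 - M%:R / (w - 1)) + \sum_(t < M) t.+1%:R * w ^+ t.+1.
Proof.
move=> w0 w1; have w1' : w - 1 != 0 by rewrite subr_eq0.
elim: M => [|M IH].
  by rewrite big_ord0 addr0 mul0r subr0 expr1; field; rewrite w0 w1'.
rewrite big_ord_recr /= IH (exprS _ M.+1) -natr1.
move: (w ^+ M.+1) (\sum_(_ < _) _) (M%:R) => a b c.
by field.
Qed.

Section ClosedForms.
Context (R : realType) (p M : nat) (P : {poly R}).
Hypothesis p1 : (1 < p)%N.
Let pR : R := p%:R.
Let q : R := pR^-1.
Let z : R := pR ^+ M.+1.
Hypothesis sP : (size P <= M.+2)%N.
Let P1 : 1 < pR. Proof. by rewrite ltr1n. Qed.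
Let P0 : 0 < pR. Proof. exact: lt_trans ltr01 P1. Qed.
Let Pn0 : pR != 0. Proof. by rewrite gt_eqF. Qed.

Let zB (t : 'I_M) : z - pR ^+ t.+1 = pR ^+ t.+1 * (pR ^+ (M - t) - 1).
Proof. by rewrite mulrBr mulr1 -exprD addSn subnKC // ltnW. Qed.

Let eB (t : 'I_M) : pR ^+ (M - t) - 1 != 0.
Proof. by rewrite subr_eq0 gt_eqF // exprn_egt1 // subn_eq0 -ltnNge. Qed.

(** The double sum is [p^(t+1)] times a divided difference of [P] between [z] and [p^(t+1)]. That
    power of [p] cancels against [z - p^(t+1) = p^(t+1) (p^(M-t) - 1)]. *)
Let dd (t : 'I_M) :
  \sum_(i < M.+2) \sum_(j < i) P`_i * z ^+ (i.-1 - j) * (pR ^+ j.+1) ^+ t.+1 =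
  (P.[z] - P.[pR ^+ t.+1]) / (pR ^+ (M - t) - 1).
Proof.
apply: (mulIf (eB t)); rewrite divfK ?eB //.
rewrite !(horner_coef_wide _ sP) -sumrB !mulr_suml; apply: eq_bigr => i _.
rewrite -mulrBr subrXX zB mulr_suml !mulr_sumr; apply: eq_bigr => j _.
have -> : (pR ^+ j.+1) ^+ t.+1 = pR ^+ t.+1 * (pR ^+ t.+1) ^+ j.
  by rewrite -!exprM -exprD -mulnS mulnC.
by move: (z ^+ _) (pR ^+ t.+1) (_ ^+ j) (pR ^+ (M - t)) => a b c d; ring.
Qed.

Let wz (i j : nat) : (j < i)%N -> z ^+ (i.-1 - j) * (pR ^+ j.+1) ^+ M.+1 = z ^+ i.
Proof.
move=> ji; rewrite -!exprM -exprD; congr (_ ^+ _).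
by rewrite [(j.+1 * _)%N]mulnC -mulnDr; congr (_ * _)%N; lia.
Qed.

Lemma divided_difference_closed :
  \sum_(i < M.+2) \sum_(j < i) P`_i * z ^+ (i.-1 - j) / (1 - q ^+ j.+1) =
  \sum_(i < M.+2) P`_i * z ^+ i * (\sum_(j < i) (pR ^+ j.+1 - 1)^-1)
  - \sum_(t < M) (P.[z] - P.[pR ^+ t.+1]) / (pR ^+ (M - t) - 1).
Proof.
under [X in _ - X]eq_bigr do rewrite -dd.
rewrite exchange_big /= -sumrB; apply: eq_bigr => i _.
rewrite exchange_big /= mulr_sumr -sumrB; apply: eq_bigr => j _.
rewrite /q exprVn (geo_sum_inv M) ?expf_neq0 //; last by rewrite gt_eqF // exprn_egt1.
by rewrite mulrBr -mulr_sumr mulrA -[_ * z ^+ _ * _]mulrA wz.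
Qed.

Lemma divided_difference_log_closed :
  \sum_(i < M.+2) \sum_(j < i) P`_i * z ^+ (i.-1 - j) * (q ^+ j.+1 / (1 - q ^+ j.+1) ^+ 2) =
  \sum_(i < M.+2) P`_i * z ^+ i *
     (\sum_(j < i) ((pR ^+ j.+1 - 1) ^- 2 - M%:R / (pR ^+ j.+1 - 1)))
  + \sum_(t < M) t.+1%:R * ((P.[z] - P.[pR ^+ t.+1]) / (pR ^+ (M - t) - 1)).
Proof.
under [X in _ + X]eq_bigr do rewrite -dd mulr_sumr.
rewrite exchange_big /= -big_split; apply: eq_bigr => i _ /=.
under [X in _ + X]eq_bigr do rewrite mulr_sumr.
rewrite exchange_big /= mulr_sumr -big_split; apply: eq_bigr => j _ /=.
rewrite /q exprVn (arithgeo_sum_inv M) ?expf_neq0 //; last by rewrite gt_eqF // exprn_egt1.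
rewrite mulrDr mulrA -[_ * z ^+ _ * _]mulrA wz //; congr (_ + _).
by rewrite mulr_sumr; apply: eq_bigr => t _; rewrite mulrCA.
Qed.

End ClosedForms.

Section IntegralityAB.
Context (R : realType) (p : nat).
Hypothesis p1 : (1 < p)%N.
Let pR : R := p%:R.
Let q : R := pR^-1.
Let P1 : 1 < pR. Proof. by rewrite ltr1n. Qed.

Let D (N : nat) : R := (dPhi N).[p%:Z]%:~R.

Let D_div (N j : nat) : (j < N)%N -> D N / (pR ^+ j.+1 - 1) \is a Num.int.
Proof.
move=> jN; have /dvdzP[c E] := @dvd_dPhi_at p j.+1 N isT jN.
have -> : D N = c%:~R * (pR ^+ j.+1 - 1).
  by rewrite /D E rmorphM /= rmorphB rmorphXn.
rewrite mulfK ?intr_int // gt_eqF // subr_gt0 exprn_egt1 //.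
Qed.

Let D_int (N : nat) : D N \is a Num.int. Proof. exact: intr_int. Qed.

Lemma b_is_int (n : nat) : (0 < n)%N -> b_ R p n \is a Num.int.
Proof.
case: n => // n _; rewrite /b_ /=.
have -> : (2 * n.+1 - 1 = n.+1 + n)%N by lia.
have H : (mlqJacobi q n.+1 n).[pR ^+ (n.+1 + n)] \is a Num.int.
  exact: horner_mlqJacobi_top_int.
by rewrite rpredM // rpredX // intr_int.
Qed.

Lemma a_is_int (n : nat) : (0 < n)%N -> a_ R p n \is a Num.int.
Proof.
case: n => // n _; rewrite /a_ /= /mlqJ_r /mlqJ_q -/pR -/q.
have -> : (2 * n.+1 - 1 = (n + n).+1)%N by lia.
have -> : (2 * n.+1 - 2 = n + n)%N by lia.
set M := (n + n)%N; set P := mlqJacobi _ _ _.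
have sP : (size P <= M.+2)%N.
  by have := size_mlqJacobi (inv_nat01 R p1) (leqnSn n); rewrite addSn.
have z1 : 1 < pR ^+ M.+1 by rewrite exprn_egt1.
rewrite (sum_from0E (@cvg_divided_difference _ _ _ _ _ (inv_nat01 R p1) z1 sP)).
rewrite (sum_from0E (@cvg_divided_difference_log _ _ _ _ _ (inv_nat01 R p1) z1 sP)).
rewrite divided_difference_closed // divided_difference_log_closed // -/(D M.+1).
set z := pR ^+ M.+1.
have cI (i : 'I_M.+2) : P`_i * z ^+ i \is a Num.int.
  by apply: (@coef_mlqJacobi_int R p p1 n.+1 n i (leqnSn n)).
have tI (t : 'I_M) : P.[pR ^+ t.+1] \is a Num.int.
  apply: (@horner_mlqJacobi_pow_int R p p1) => //=; have := ltn_ord t.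
  by rewrite /M; lia.
have zI : P.[z] \is a Num.int by apply: horner_mlqJacobi_top_int.
have ddI (t : 'I_M) : D M.+1 * ((P.[z] - P.[pR ^+ t.+1]) / (pR ^+ (M - t) - 1)) \is a Num.int.
  rewrite mulrCA; apply: rpredM; first exact: rpredB.
  have -> : (M - t = (M - t).-1.+1)%N by have := ltn_ord t; lia.
  by apply: D_div; lia.
have qI : D M.+1 * (\sum_(i < M.+2) P`_i * z ^+ i * (\sum_(j < i) (pR ^+ j.+1 - 1)^-1)
    - \sum_(t < M) (P.[z] - P.[pR ^+ t.+1]) / (pR ^+ (M - t) - 1)) \is a Num.int.
  rewrite mulrBr; apply: rpredB; rewrite mulr_sumr; apply: rpred_sum => i _ //.
  rewrite mulrCA; apply: rpredM => //; rewrite mulr_sumr; apply: rpred_sum => j _.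
  by apply: D_div; have := ltn_ord i; have := ltn_ord j; lia.
(* The squared denominators [(p^(j+1) - 1)^2] are what calls for the square of [d_N(p)]. *)
have rI : D M.+1 ^+ 2 * (\sum_(i < M.+2) P`_i * z ^+ i *
     (\sum_(j < i) ((pR ^+ j.+1 - 1) ^- 2 - M%:R / (pR ^+ j.+1 - 1)))
  + \sum_(t < M) t.+1%:R * ((P.[z] - P.[pR ^+ t.+1]) / (pR ^+ (M - t) - 1))) \is a Num.int.
  rewrite mulrDr; apply: rpredD; rewrite mulr_sumr; apply: rpred_sum => i _; last first.
    rewrite expr2 -mulrA; apply: rpredM => //; rewrite mulrCA; apply: rpredM => //.
    exact: rpred_nat.
  rewrite mulrCA; apply: rpredM => //; rewrite mulr_sumr; apply: rpred_sum => j _.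
  have DI : D M.+1 / (pR ^+ j.+1 - 1) \is a Num.int.
    by apply: D_div; have := ltn_ord i; have := ltn_ord j; lia.
  rewrite mulrBr -exprVn -exprMn; apply: rpredB; first exact: rpredX.
  rewrite expr2 -mulrA; apply: rpredM => //; rewrite mulrCA; apply: rpredM => //.
  exact: rpred_nat.
rewrite mulrDr; apply: rpredD.
  rewrite mulrDr; apply: rpredD => //.
  rewrite mulrCA; apply: rpredM => //; rewrite mulr_sumr big_seq_cond; apply: rpred_sum.
  move=> k; rewrite mem_index_iota => /andP[/andP[k0 kM] _].
  rewrite expr2 -mulrA; apply: rpredM => //; rewrite mulrCA; apply: rpredM; first exact: rpred_nat.
  by case: k k0 kM => // k _ kM; apply: D_div; lia.
rewrite mulrCA; apply: rpredM; first exact: rpred_nat.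
rewrite expr2 -mulrA; apply: rpredM => //.
Qed.

End IntegralityAB.

(** * The linear form *)

Lemma cvg_series_le (R : realType) (u v : nat -> R) (a b : R) :
  series u @ \oo --> a -> series v @ \oo --> b -> (forall k, `|u k| <= v k) ->
  `|a| <= b.
Proof.
move=> hu hv uv.
have hn : `|series u n| @[n --> \oo] --> `|a| by exact: cvg_norm hu.
apply: (ler_cvg_to hn hv); near=> n.
by apply: (le_trans (ler_norm_sum _ _ _)); apply: ler_sum.
Unshelve. all: by end_near. Qed.

Lemma zeta_cvg (R : realType) (q : R) : 0 < q < 1 ->
  series (fun k => k%:R * q ^+ k / (1 - q ^+ k)) @ \oo --> zeta_q2 q.
Proof.
move=> /andP[q0 q1]; set u := (fun k => _).
have E : zeta_q2 q = limn (series u).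
  (* Starting at [0] instead of [1] is harmless: the extra term has the factor [k = 0]. *)
  rewrite /zeta_q2 /sum_from; congr (lim (_ @ \oo)); apply/funext => -[|n].
    by rewrite /series /= !big_geq.
  rewrite /series /= [RHS]big_ltn // {1}/u mul0r mul0r add0r.
  by apply: eq_bigr.
rewrite E.
pose v (k : nat) := (1 - q)^-1 * (k%:R * q ^+ k).
have q1' : 0 < 1 - q by rewrite subr_gt0.
have u0 k : 0 <= u k.
  rewrite /u; case: k => [|k]; first by rewrite mul0r mul0r.
  by rewrite divr_ge0 ?mulr_ge0 ?exprn_ge0 ?(ltW q0) // subr_ge0 exprn_ile1 // ltW.
apply: (@series_le_cvg R u v) => //.
- by move=> k; rewrite /v mulr_ge0 ?invr_ge0 ?(ltW q1') // mulr_ge0 // exprn_ge0 // ltW.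
- case=> [|k]; first by rewrite /u /v !mul0r mulr0.
  rewrite /u /v mulrC ler_wpM2r ?mulr_ge0 ?exprn_ge0 ?(ltW q0) //.
  rewrite lef_pV2 ?posrE ?subr_gt0 ?exprn_ilt1 ?(ltW q0) // lerD2l lerN2.
  by rewrite exprS ler_piMr ?(ltW q0) // exprn_ile1 // ltW.
- apply/cvg_ex; eexists; apply: cvg_seriesZ; apply: cvg_arithgeo.
  by rewrite ltW.
Qed.

Section RemainderSeries.
Context (R : realType) (q : R) (N : nat) (P : {poly R}).
Hypothesis q01 : 0 < q < 1.
Hypothesis N0 : (0 < N)%N.
Hypothesis sP : (size P <= N.+1)%N.
Let q0 : 0 < q. Proof. by case/andP: q01. Qed.
Let q1 : q < 1. Proof. by case/andP: q01. Qed.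
Let z : R := q ^- N.

Let z1 : 1 < z.
Proof. by rewrite /z invf_gt1 ?exprn_gt0 // exprn_ilt1 // -?lt0n // ltW. Qed.

Let zq (l : nat) : 0 < z - q ^+ l.
Proof. by rewrite subr_gt0 (le_lt_trans (qexp_le1 q01 l)). Qed.

Let zq0 (l : nat) : z - q ^+ l != 0. Proof. by rewrite gt_eqF. Qed.

(** Up to the factor [z^-k], what is left of the [l]-th summand after [k] terms of the geometric
    expansion of [1 / (z - q^l)]. *)
Definition rem_term (k l : nat) : R :=
  (l + N)%:R * q ^+ l * P.[q ^+ l] * q ^+ (l * k) / (z - q ^+ l).

(** For [q = 1/p] this is [(b_n zeta_q(2) - a_n) / d_N(p)^2], by [linear_formE]. *)
Definition remainder : R :=
  P.[z] * (zeta_q2 q - \sum_(0 <= k < N) k%:R * q ^+ k / (1 - q ^+ k))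
  - sum_from 0 (fun l => (P.[z] - P.[q ^+ l]) / (z - q ^+ l) * l%:R * q ^+ l)
  - N%:R * sum_from 0 (fun l => (P.[z] - P.[q ^+ l]) / (z - q ^+ l) * q ^+ l).

(** Since [z = q^-N], the zeta series from index [N] on is [sum_l (l + N) q^l / (z - q^l)]. Against
    the divided differences the terms in [P(z)] cancel and only [P(q^l)] remains. *)
Lemma cvg_remainder : series (rem_term 0) @ \oo --> remainder.
Proof.
rewrite /remainder (sum_from0E (@cvg_divided_difference _ _ _ _ _ q01 z1 sP)).
rewrite (sum_from0E (@cvg_divided_difference_log _ _ _ _ _ q01 z1 sP)).
have -> : rem_term 0 = (fun l => (P.[z] * ((l + N)%:R * q ^+ (l + N) / (1 - q ^+ (l + N)))
   - (P.[z] - P.[q ^+ l]) / (z - q ^+ l) * l%:R * q ^+ l)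
   - N%:R * ((P.[z] - P.[q ^+ l]) / (z - q ^+ l) * q ^+ l)).
  apply/funext => l; rewrite /rem_term muln0 expr0 mulr1.
  have h1 : q ^+ N != 0 by rewrite expf_neq0 // gt_eqF.
  have h2 := zq0 l.
  have -> : (l + N)%:R * q ^+ (l + N) / (1 - q ^+ (l + N)) =
      (l + N)%:R * (q ^+ l / (z - q ^+ l)).
    have E : 1 - q ^+ l * q ^+ N = q ^+ N * (z - q ^+ l).
      by rewrite mulrBr /z divff // [_ * q ^+ l]mulrC.
    by rewrite exprD E; field; rewrite h1 h2.
  by rewrite natrD; field.
apply: cvg_seriesB; last by apply: cvg_seriesZ; exact: cvg_divided_difference.
apply: cvg_seriesB; last exact: cvg_divided_difference_log.
apply: cvg_seriesZ.
exact: (@cvg_series_shift R (fun k => k%:R * q ^+ k / (1 - q ^+ k)) _ N (zeta_cvg q01)).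
Qed.

Definition rem_piece (k : nat) : R :=
  z ^- k.+1 * (q ^+ k * (((partial_numer N (qnode q) P)^`().[q ^+ k]
     * (nodal_poly N (qnode q)).[q ^+ k]
     - (partial_numer N (qnode q) P).[q ^+ k] * (nodal_poly N (qnode q))^`().[q ^+ k])
    / (nodal_poly N (qnode q)).[q ^+ k] ^+ 2)
   + N%:R * ((partial_numer N (qnode q) P).[q ^+ k] / (nodal_poly N (qnode q)).[q ^+ k])).

Lemma cvg_rem_piece (k : nat) :
  series (fun l => z ^- k.+1 * ((l + N)%:R * q ^+ l * P.[q ^+ l] * q ^+ (l * k))) @ \oo
    --> rem_piece k.
Proof.
apply: cvg_seriesZ.
have -> : (fun l => (l + N)%:R * q ^+ l * P.[q ^+ l] * q ^+ (l * k)) =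
   (fun l => l%:R * q ^+ l * P.[q ^+ l] * q ^+ (l * k)
      + N%:R * (q ^+ l * P.[q ^+ l] * q ^+ (l * k))).
  by apply/funext => l; rewrite natrD; ring.
apply: cvg_seriesD; first exact: cvg_qmoment_log.
by apply: cvg_seriesZ; exact: cvg_qmoment.
Qed.

(** A finite geometric expansion of [1 / (z - q^l)]; its exact remainder term avoids exchanging two
    infinite sums. *)
Lemma cvg_rem_tail (K : nat) :
  series (fun l => z ^- K * rem_term K l) @ \oo --> remainder - \sum_(k < K) rem_piece k.
Proof.
have -> : (fun l => z ^- K * rem_term K l) = (fun l => rem_term 0 l -
   \sum_(k < K) z ^- k.+1 * ((l + N)%:R * q ^+ l * P.[q ^+ l] * q ^+ (l * k))).
  apply/funext => l; elim: K => [|K IH].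
    by rewrite big_ord0 subr0 expr0 invr1 mul1r.
  rewrite big_ord_recr /= opprD addrA -IH /rem_term mulnS exprD.
  have h1 : z ^+ K != 0 by rewrite expf_neq0 // gt_eqF // (lt_trans ltr01).
  have h3 : z != 0 by rewrite gt_eqF // (lt_trans ltr01).
  have h2 := zq0 l; rewrite exprS.
  move: ((l + N)%:R) (P.[q ^+ l]) (q ^+ (l * K)) (q ^+ l) (z ^+ K) h1 h2 => a b c d e h1 h2.
  by field; rewrite h1 h2 h3.
apply: cvg_seriesB; first exact: cvg_remainder.
by apply: cvg_series_sum => k; exact: cvg_rem_piece.
Qed.

(** The tail is bounded uniformly in [K] by [|P(q^l)| <= B], [z - q^l >= z - 1] and
    [q^(l K) <= 1]. *)
Lemma remainder_approx : exists c : R, forall K : nat,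
  `|remainder - \sum_(k < K) rem_piece k| <= z ^- K * c.
Proof.
pose B := \sum_(i < N.+1) `|P`_i|.
have zp : 0 < z - 1 by rewrite subr_gt0.
have hv : series (fun l => l%:R * q ^+ l + N%:R * q ^+ l) @ \oo -->
    q / (1 - q) ^+ 2 + N%:R * (1 - q)^-1.
  apply: cvg_seriesD; first by apply: cvg_arithgeo; rewrite ltW.
  by apply: cvg_seriesZ; apply: cvg_geo; rewrite ltW.
exists (B / (z - 1) * (q / (1 - q) ^+ 2 + N%:R * (1 - q)^-1)) => K.
rewrite mulrA; apply: (cvg_series_le (@cvg_rem_tail K) (@cvg_seriesZ _ _ _ _ hv)) => l.
have zK : 0 < z ^- K by rewrite invr_gt0 exprn_gt0 // (lt_trans ltr01).
rewrite normrM gtr0_norm // -mulrA (ler_wpM2l (ltW zK)) //.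
rewrite /rem_term -mulrDl -natrD.
have ql0 j : 0 <= q ^+ j by rewrite exprn_ge0 // ltW.
rewrite !normrM normfV (gtr0_norm (zq l)) normr_nat !(ger0_norm (ql0 _)).
have hP : `|P.[q ^+ l]| <= B.
  rewrite (horner_coef_wide _ sP); apply: (le_trans (ler_norm_sum _ _ _)).
  apply: ler_sum => i _; rewrite normrM ler_piMr // -exprM ger0_norm //.
  exact: qexp_le1.
have hz : (z - q ^+ l)^-1 <= (z - 1)^-1.
  by rewrite lef_pV2 ?posrE // lerD2l lerN2; exact: qexp_le1.
have hq : q ^+ (l * K) <= 1 by exact: qexp_le1.
have h0 : 0 <= (l + N)%:R * q ^+ l by rewrite mulr_ge0.
have -> : B / (z - 1) * ((l + N)%:R * q ^+ l) = ((l + N)%:R * q ^+ l * B * 1) * (z - 1)^-1.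
  by rewrite mulr1; ring.
apply: ler_pM => //; rewrite ?mulr_ge0 ?invr_ge0 ?(ltW (zq l)) //.
by apply: ler_pM => //; rewrite ?mulr_ge0 // ler_wpM2l.
Qed.

Lemma cvg_rem_pieces : (fun K => \sum_(k < K) rem_piece k) @ \oo --> remainder.
Proof.
have [c hc] := remainder_approx; apply/cvgrPdist_le => e e0.
have : (fun K => (z^-1) ^+ K * c) @ \oo --> (0 : R).
  have zp : 0 < z by exact: lt_trans z1.
  have zV : 0 < z^-1 by rewrite invr_gt0.
  rewrite -[X in _ --> X](mul0r c); apply: cvgMl; apply: cvg_expr.
  by rewrite (ger0_norm (ltW zV)) invf_lt1.
move=> /cvgrPdist_le/(_ e e0); apply: filterS => K.
rewrite sub0r normrN exprVn => h; apply: (le_trans (hc K)); apply: le_trans h.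
exact: ler_norm.
Qed.

End RemainderSeries.

(** * Two-sided estimate of the linear form *)

Lemma deriv_prod_log (F : fieldType) (I : Type) (r : seq I) (f : I -> {poly F}) (y : F) :
  (forall i, (f i).[y] != 0) ->
  (\prod_(i <- r) f i)^`().[y] =
  (\prod_(i <- r) f i).[y] * \sum_(i <- r) (f i)^`().[y] / (f i).[y].
Proof.
move=> h; elim: r => [|i r IH]; first by rewrite !big_nil derivC horner0 mulr0.
rewrite !big_cons derivM hornerD !hornerM IH.
by move: (\prod_(_ <- _) _).[_] (\sum_(_ <- _) _) (h i) => u v hi; field.
Qed.

Section Estimates.
Context (R : realType) (q : R) (m : nat).
Hypothesis q01 : 0 < q < 1.
Hypothesis q2 : q <= 1 / 2.
Let q0 : 0 < q. Proof. by case/andP: q01. Qed.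
Let q1 : q < 1. Proof. by case/andP: q01. Qed.
Let N := (m.+1 + m)%N.
Let z : R := q ^- N.
Let x := qnode q.
Let A := qroots q m.
Let C := jacobi_const q m.+1 m.
Let W := nodal_poly N x.
Let c := q ^+ m.
Let P := mlqJacobi q m.+1 m.

Let qp (j : nat) : 0 < q ^+ j. Proof. by rewrite exprn_gt0. Qed.

Lemma jacobi_const_gt0 : 0 < C.
Proof.
rewrite /C /jacobi_const divr_gt0 ?mulr_gt0 ?qroots_qnode_gt0 ?qnode_gt0 //.
rewrite horner_cofactor prodr_gt0 // => j j0; rewrite subr_gt0 /qnode ltf_pV2 ?posrE ?qp //.
by rewrite ltr_iXn2l // ltnS lt0n; apply: contraNneq j0 => j0; apply/eqP/val_inj.
Qed.

Lemma nodal_gt0 (k : nat) : 0 < W.[q ^+ k].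
Proof.
rewrite horner_nodal prodr_gt0 // => j _.
by rewrite subr_gt0 (le_lt_trans (qexp_le1 q01 k)) // qnode_gt1.
Qed.

Lemma nodal_homo (k : nat) : (m <= k)%N -> W.[c] <= W.[q ^+ k].
Proof.
move=> mk; rewrite !horner_nodal; apply: ler_prod => j _.
rewrite subr_ge0 ltW /=; last by rewrite (le_lt_trans (qexp_le1 q01 m)) // qnode_gt1.
by rewrite lerD2l lerN2 ler_wiXn2l // ltW.
Qed.

Lemma numer_factor : partial_numer N x P = C *: (A * ('X - c%:P) * A).
Proof.
rewrite /P /N /x (numer_mlqJacobi q01 (leqnSn m) (mlqJacobi_spec q01 (leqnSn m))).
by congr (_ *: (_ * _)); rewrite /qroots big_ord_recr.
Qed.

(** The piece [k = m]: [S] has a simple zero at [c], so only [S'(c) = C A(c)^2 / W(c)]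
    contributes. *)
Definition main_piece : R := z ^- m.+1 * (c * (C * A.[c] ^+ 2 / W.[c])).

Lemma horner_A_root (k : nat) : (k < m)%N -> A.[q ^+ k] = 0.
Proof. exact: qroots_root. Qed.

Lemma rem_piece_lt (k : nat) : (k < m)%N -> rem_piece q N P k = 0.
Proof.
move=> km; rewrite /rem_piece -/x numer_factor derivZ !derivM !hornerE /= (horner_A_root km).
by rewrite !(mulr0, mul0r, addr0, subr0).
Qed.

Lemma rem_piece_m : rem_piece q N P m = main_piece.
Proof.
rewrite /rem_piece -/x -/W -/c numer_factor derivZ !derivM derivXsubC !hornerE /=.
rewrite subrr !(mulr0, mul0r, addr0, subr0, add0r) /main_piece -/z.
have W0 : W.[c] != 0 by rewrite gt_eqF // nodal_gt0.
congr (_ * _); move: c C A.[c] W.[c] W0 => c' C' a w w0.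
by field.
Qed.

(* [B] is [N] plus the logarithmic derivative [y * S'/S] of [S = numerator / nodal polynomial]. *)
Let B (y : R) : R := N%:R - y / (c - y) - 2 * (\sum_(l < m) y / (q ^+ l - y))
  + \sum_(j < N.+1) y / (x j - y).

(** This is [- z^-(k+1) S(q^k)], nonnegative for [k > m] because then [q^k < c]. *)
Let u (k : nat) : R := z ^- k.+1 * (C * ((c - q ^+ k) * A.[q ^+ k] ^+ 2) / W.[q ^+ k]).

Let ylt (k l : nat) : (l < k)%N -> q ^+ k < q ^+ l.
Proof. by move=> lk; rewrite ltr_iXn2l. Qed.

Lemma rem_piece_gt (k : nat) : (m < k)%N -> rem_piece q N P k = - (u k * B (q ^+ k)).
Proof.
move=> mk; rewrite /rem_piece /u -/x -/W numer_factor -/z.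
move: C => C'; rewrite derivZ !derivM derivXsubC !hornerE /=.
set y := q ^+ k.
have W0 : W.[y] != 0 by rewrite gt_eqF // nodal_gt0.
have cy : c - y != 0 by rewrite gt_eqF // subr_gt0 ylt.
have AE : A^`().[y] = A.[y] * (- \sum_(l < m) (q ^+ l - y)^-1).
  rewrite /A /qroots deriv_prod_log; last first.
    move=> [l lm]; rewrite !hornerE subr_eq0 lt_eqF // ylt //.
    exact: ltn_trans mk.
  congr (_ * _); rewrite -sumrN; apply: eq_bigr => l _.
  by rewrite derivXsubC !hornerE /= -invrN opprB ?mul1r ?div1r.
have WE : W^`().[y] = W.[y] * (- \sum_(j < N.+1) (x j - y)^-1).
  rewrite /W /nodal_poly deriv_prod_log; last first.
    by move=> j; rewrite !hornerE qnode_sub_neq0.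
  congr (_ * _); rewrite -sumrN; apply: eq_bigr => l _.
  by rewrite derivB derivC derivX !hornerE mulN1r.
rewrite AE WE /B -!mulr_sumr.
move: (\sum_(l < m) _) (\sum_(j < N.+1) _) (A.[y]) (W.[y]) W0 (z ^- k.+1) => s t a w w0 d.
by field; rewrite w0 cy.
Qed.

(** As [q <= 1/2], each [y / (q^l - y)] with [l < k] is at most [1]. With multiplicity [1 + 2m = N]
    of them are subtracted, which [N] just offsets. *)
Lemma log_factor_ge0 (k : nat) : (m < k)%N -> 0 <= B (q ^+ k).
Proof.
move=> mk; rewrite /B; set y := q ^+ k.
have h l : (l < k)%N -> y / (q ^+ l - y) <= 1.
  move=> lk; have yl := ylt lk; rewrite ler_pdivrMr ?subr_gt0 // mul1r.
  have : y <= q ^+ l.+1 by rewrite /y ler_wiXn2l // ltW.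
  rewrite exprS; have := ler_wpM2r (ltW (qp l)) q2; lra.
have h1 := h m mk.
have h2 : \sum_(l < m) y / (q ^+ l - y) <= m%:R.
  have -> : m%:R = \sum_(l < m) (1 : R) by rewrite sumr_const card_ord.
  by apply: ler_sum => l _; apply: h; apply: ltn_trans mk.
have h3 : 0 <= \sum_(j < N.+1) y / (x j - y).
  apply: sumr_ge0 => j _; rewrite divr_ge0 ?(ltW (qp _)) // subr_ge0.
  by rewrite (le_trans (qexp_le1 q01 k)) // ltW // qnode_gt1.
have -> : N%:R = 1 + 2 * m%:R :> R by rewrite /N natrD -natr1; ring.
rewrite -/c in h1; lra.
Qed.

Lemma sum_qexp_le1 (M : nat) : \sum_(j < M) q ^+ j.+1 <= 1 - q ^+ M.
Proof.
elim: M => [|M IH]; first by rewrite big_ord0 expr0 subrr.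
rewrite big_ord_recr /= exprS; have := ler_wpM2r (ltW (qp M)) q2; lra.
Qed.

(** From [x_j - y >= x_j (1 - y)] and [sum_j 1/x_j <= 1] the sum over the poles is at most
    [y / (1 - y)], which the term [y / (c - y)] outweighs. *)
Lemma log_factor_leN (k : nat) : (m < k)%N -> B (q ^+ k) <= N%:R.
Proof.
move=> mk; rewrite /B; set y := q ^+ k.
have y0 : 0 < y by exact: qp.
have y1 : y < 1 by rewrite /y -(expr0 q) ylt // (leq_ltn_trans _ mk).
have yc : y < c by exact: ylt.
have c1 : c <= 1 by exact: qexp_le1.
have h2 : 0 <= \sum_(l < m) y / (q ^+ l - y).
  apply: sumr_ge0 => l _; rewrite divr_ge0 ?(ltW y0) // subr_ge0 ltW // ylt //.
  exact: ltn_trans mk.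
suff h3 : \sum_(j < N.+1) y / (x j - y) <= y / (c - y) by lra.
apply: (@le_trans _ _ (y / (1 - y))); last first.
  by rewrite ler_pM2l // lef_pV2 ?posrE ?subr_gt0 // lerD2r.
apply: (@le_trans _ _ (\sum_(j < N.+1) q ^+ j.+1 * (y / (1 - y)))).
  apply: ler_sum => j _; rewrite mulrCA ler_pM2l //.
  have xE : x j = (q ^+ j.+1)^-1 by [].
  have -> : q ^+ j.+1 / (1 - y) = (x j * (1 - y))^-1 by rewrite invfM xE invrK.
  have x1 : 1 < x j by exact: qnode_gt1.
  by rewrite lef_pV2 ?posrE ?mulr_gt0 ?subr_gt0 //; [nra | lra | lra].
rewrite -mulr_suml ler_piMl ?divr_ge0 ?(ltW y0) ?subr_ge0 ?(ltW y1) //.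
by apply: (le_trans (sum_qexp_le1 _)); rewrite gerBl ltW.
Qed.

(** The q-Pochhammer symbol [(q;q)_k]. *)
Definition kappa (k : nat) : R := \prod_(j < k) (1 - q ^+ j.+1).

Let oneB (j : nat) : 0 < 1 - q ^+ j.+1.
Proof. by rewrite subr_gt0 exprn_ilt1 // ltW. Qed.

Lemma kappa_gt0 (k : nat) : 0 < kappa k.
Proof. by rewrite prodr_gt0. Qed.

Lemma sqr_horner_A_top : A.[c] ^+ 2 = (\prod_(l < m) q ^+ l) ^+ 2 * kappa m ^+ 2.
Proof.
rewrite /A horner_qroots.
have -> : \prod_(l < m) (c - q ^+ l) = \prod_(l < m) (-1 * (q ^+ l * (1 - q ^+ (m - l)))).
  apply: eq_bigr => l _; rewrite mulrBr mulr1 -exprD subnKC 1?ltnW //.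
  by rewrite mulN1r opprB.
rewrite !big_split /= prodr_const !exprMn -exprM mulnC exprM sqrrN expr1n expr1n mul1r.
congr (_ * _ ^+ 2); rewrite /kappa (reindex_inj rev_ord_inj) /=; apply: eq_bigr => j _.
by congr (_ - _ ^+ _); have := ltn_ord j; lia.
Qed.

(** For [l < m <= k] the factor [|q^k - q^l|] is at most [q^l]; at [c] it is [q^l (1 - q^(m-l))],
    whence [kappa m]. *)
Lemma sqr_horner_A_le (k : nat) : (m <= k)%N -> A.[q ^+ k] ^+ 2 <= A.[c] ^+ 2 / kappa m ^+ 2.
Proof.
move=> mk; rewrite sqr_horner_A_top mulfK; last by rewrite expf_neq0 // gt_eqF // kappa_gt0.
have hp : 0 <= \prod_(l < m) q ^+ l by rewrite prodr_ge0 // => l _; rewrite ltW.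
rewrite -(real_normK (num_real A.[_])) lerXn2r ?nnegrE //.
rewrite /A horner_qroots normr_prod; apply: ler_prod => l _.
rewrite normr_ge0 /= distrC ger0_norm; first by rewrite gerBl ltW.
rewrite subr_ge0 ler_wiXn2l ?(ltW q0) ?(ltW q1) //.
exact: leq_trans (ltnW (ltn_ord l)) mk.
Qed.

Lemma main_piece_gt0 : 0 < main_piece.
Proof.
rewrite /main_piece mulr_gt0 ?invr_gt0 ?exprn_gt0 ?invr_gt0 //.
rewrite mulr_gt0 ?qp // divr_gt0 ?nodal_gt0 // mulr_gt0 ?jacobi_const_gt0 // sqr_horner_A_top.
rewrite mulr_gt0 ?exprn_gt0 ?kappa_gt0 // prodr_gt0 // => j _; exact: qp.
Qed.

Lemma tail_piece_ge0 (k : nat) : (m < k)%N -> 0 <= u k.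
Proof.
move=> mk; rewrite /u mulr_ge0 ?invr_ge0 ?exprn_ge0 ?invr_ge0 ?(ltW (qp _)) //.
rewrite divr_ge0 ?(ltW (nodal_gt0 _)) // mulr_ge0 ?(ltW jacobi_const_gt0) // mulr_ge0 ?sqr_ge0 //.
by rewrite subr_ge0 ltW // ylt.
Qed.

Lemma tail_piece_le (s : nat) : (0 < s)%N ->
  u (m + s) <= main_piece * (kappa m ^- 2 * ((q ^+ N) ^+ s * (1 - q ^+ s))).
Proof.
move=> s0; rewrite /u /main_piece.
have zE : z ^- (m + s).+1 = z ^- m.+1 * (q ^+ N) ^+ s.
  by rewrite -addSn exprD invfM; congr (_ * _); rewrite /z -exprVn invrK.
have cE : c - q ^+ (m + s) = c * (1 - q ^+ s) by rewrite exprD mulrBr mulr1.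
rewrite zE cE.
have z0 : 0 < z by rewrite invr_gt0.
have hA := sqr_horner_A_le (leq_addr s m); have hW := nodal_homo (leq_addr s m).
have W0 := nodal_gt0 m; have C0 := jacobi_const_gt0; have k0 := kappa_gt0 m.
have s1 : 0 <= 1 - q ^+ s by case: s s0 {zE cE hA hW} => // s _; rewrite ltW.
have -> : z ^- m.+1 * (c * (C * A.[c] ^+ 2 / W.[c])) *
    (kappa m ^- 2 * ((q ^+ N) ^+ s * (1 - q ^+ s))) =
  z ^- m.+1 * (q ^+ N) ^+ s * (C * (c * (1 - q ^+ s) * (A.[c] ^+ 2 / kappa m ^+ 2)) / W.[c]).
  by field; rewrite !gt_eqF // exprn_gt0.
have d0 : 0 <= z ^- m.+1 * (q ^+ N) ^+ s.
  apply: mulr_ge0; last by apply: exprn_ge0; exact: ltW (qp _).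
  by rewrite invr_ge0; apply: exprn_ge0; exact: ltW.
apply: (ler_wpM2l d0); apply: ler_pM.
- apply: (mulr_ge0 (ltW C0)); apply: mulr_ge0 (sqr_ge0 _).
  exact: mulr_ge0 (ltW (qp m)) s1.
- by rewrite invr_ge0 ltW // nodal_gt0.
- apply: (ler_wpM2l (ltW C0)); apply: ler_wpM2l hA.
  exact: mulr_ge0 (ltW (qp m)) s1.
- by rewrite lef_pV2 ?posrE ?nodal_gt0.
Qed.

(** The left side decreases in [k]: each step multiplies it by at most [5/3 * 1/4 * 16/9 < 1], so
    its value at [k = 0] is the bound. *)
Lemma kappa_decay (k : nat) :
  (2 * k.+1 + 1)%:R * q ^+ (2 * k.+1) / kappa k.+1 ^+ 2 <= 3 * q ^+ 2 / (1 - q) ^+ 2.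
Proof.
elim: k => [|k IH]; first by rewrite /kappa big_ord1 expr1.
apply: le_trans IH.
have E : kappa k.+2 = kappa k.+1 * (1 - q ^+ k.+2) by rewrite /kappa big_ord_recr.
have k0 := kappa_gt0 k.+1; have o0 := oneB k.+1.
have -> : (2 * k.+2 + 1)%:R * q ^+ (2 * k.+2) / kappa k.+2 ^+ 2 =
   (q ^+ (2 * k.+1) / kappa k.+1 ^+ 2) * ((2 * k.+2 + 1)%:R * q ^+ 2 / (1 - q ^+ k.+2) ^+ 2).
  rewrite E (_ : (2 * k.+2 = 2 * k.+1 + 2)%N); last by lia.
  rewrite exprD; move: (_%:R) (q ^+ (2 * _)) (1 - _) o0 k0 => a b d d0; move: (kappa _) => e e0.
  by field; rewrite !gt_eqF.
rewrite -[X in _ <= X]mulrA [X in _ <= X]mulrC; apply: ler_wpM2l.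
  by rewrite divr_ge0 ?exprn_ge0 ?(ltW q0) ?(ltW k0).
rewrite ler_pdivrMr ?exprn_gt0 //.
have h3 : q ^+ 2 <= 1 / 4.
  by rewrite expr2; have := ler_pM (ltW q0) (ltW q0) q2 q2; lra.
have h : q ^+ k.+2 <= 1 / 4.
  by apply: le_trans h3; rewrite ler_wiXn2l // ltW.
have h2 : 9 / 16 <= (1 - q ^+ k.+2) ^+ 2.
  have g : 3 / 4 <= 1 - q ^+ k.+2 by lra.
  have g0 : 0 <= 3 / 4 :> R by lra.
  by rewrite expr2; have := ler_pM g0 g0 g g; lra.
have h4 : (2 * k.+2 + 1)%:R <= 5 / 3 * (2 * k.+1 + 1)%:R :> R.
  have -> : (2 * k.+2 + 1)%:R = 2 * k%:R + 5 :> R by rewrite natrD natrM -!natr1; ring.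
  have -> : (2 * k.+1 + 1)%:R = 2 * k%:R + 3 :> R by rewrite natrD natrM -!natr1; ring.
  have : 0 <= k%:R :> R by [].
  lra.
have h5 : 0 <= (2 * k.+1 + 1)%:R :> R by [].
have h6 := ler_pM (ler0n _ _) (sqr_ge0 q) h4 h3.
have h7 := ler_wpM2l h5 h2.
move: ((2 * k.+2 + 1)%:R) ((2 * k.+1 + 1)%:R) (q ^+ 2) ((1 - q ^+ k.+2) ^+ 2) h5 h6 h7.
move=> a1 a2 a3 a4 h5 h6 h7; lra.
Qed.

Lemma geo_diff_sum (a b : R) (S : nat) : 0 <= b -> b <= a -> a < 1 ->
  \sum_(s < S) (a ^+ s.+1 - b ^+ s.+1) <= a / (1 - a) - b / (1 - b).
Proof.
move=> b0 ba a1.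
have E : \sum_(s < S) (a ^+ s.+1 - b ^+ s.+1) =
   a / (1 - a) - b / (1 - b) - (a ^+ S.+1 / (1 - a) - b ^+ S.+1 / (1 - b)).
  elim: S => [|S IH]; first by rewrite big_ord0 !expr1; ring.
  rewrite big_ord_recr /= IH (exprS a S.+1) (exprS b S.+1).
  move: (a ^+ S.+1) (b ^+ S.+1) => u1 v1; field.
  by rewrite !subr_eq0 !gt_eqF // (le_lt_trans ba).
rewrite E gerBl subr_ge0; apply: ler_pM.
- by rewrite exprn_ge0.
- by rewrite invr_ge0 subr_ge0 (le_trans ba) // ltW.
- by rewrite lerXn2r // nnegrE // (le_trans b0).
- by rewrite lef_pV2 ?posrE ?subr_gt0 ?(le_lt_trans ba) // lerD2l lerN2.
Qed.

(** With [B <= N] and [tail_piece_le], this bounds the later pieces relative to the main one. The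
    case [m = 0] is separate because [kappa_decay] starts at [m = 1]; there the ratio is at most
    [q / (1 - q^2) <= 2/3]. *)
Lemma tail_ratio (S : nat) :
  N%:R * (kappa m ^- 2 * \sum_(s < S) ((q ^+ N) ^+ s.+1 * (1 - q ^+ s.+1))) <= 19 / 20.
Proof.
have N2 : (2 * m + 1 = N)%N by rewrite /N mul2n -addnn addn1.
pose a := q ^+ N; pose b := q ^+ N.+1.
have q2' := q2; have q0' := q0.
have a1 : a < 1 by rewrite exprn_ilt1 // ltW.
have b1 : b < 1 by rewrite exprn_ilt1 // ltW.
have ba : b = a * q by rewrite /a /b exprSr.
have bl : b <= a by rewrite ba ler_piMr ?(ltW (qp _)) // ltW.
have k0 := kappa_gt0 m.
have hk : 0 <= N%:R * kappa m ^- 2 by rewrite mulr_ge0 // invr_ge0 exprn_ge0 // ltW.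
have h1 : \sum_(s < S) ((q ^+ N) ^+ s.+1 * (1 - q ^+ s.+1)) <= a / (1 - a) - b / (1 - b).
  rewrite (eq_bigr (fun s : 'I_S => a ^+ s.+1 - b ^+ s.+1)).
    by apply: geo_diff_sum => //; exact: ltW (qp _).
  by move=> s _; rewrite mulrBr mulr1 ba exprMn.
rewrite mulrA; apply: (le_trans (ler_wpM2l hk h1)).
have E : a / (1 - a) - b / (1 - b) = a * (1 - q) / ((1 - a) * (1 - b)).
  by rewrite ba; field; rewrite !subr_eq0 -ba !gt_eqF.
rewrite E; have q1' : 0 < 1 - q by rewrite subr_gt0.
case: (posnP m) => [m0|m0].
  have aE : a = q by rewrite /a /N m0 expr1.
  have bE : b = q ^+ 2 by rewrite ba aE expr2.
  have -> : N%:R * kappa m ^- 2 = 1 by rewrite /N m0 /kappa big_ord0 expr1n invr1 mulr1.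
  rewrite mul1r aE bE.
  have q21 : 0 < 1 - q ^+ 2 by rewrite subr_gt0 exprn_ilt1 // ltW.
  have -> : q * (1 - q) / ((1 - q) * (1 - q ^+ 2)) = q / (1 - q ^+ 2).
    by field; rewrite !gt_eqF.
  rewrite ler_pdivrMr // expr2; have h5 := ler_pM (ltW q0) (ltW q0) q2 q2; lra.
have hd : N%:R * kappa m ^- 2 * q ^+ (2 * m) <= 3 * q ^+ 2 / (1 - q) ^+ 2.
  by have := kappa_decay m.-1; rewrite prednK // N2 mulrAC.
have aE : a = q * q ^+ (2 * m) by rewrite /a -exprS -N2 addn1.
have N3 : (3 <= N)%N by rewrite -N2 addn1 ltnS -{1}[2%N]muln1 leq_pmul2l.
have q3 : q ^+ 3 <= 1 / 8.
  by have := @lerXn2r R 3 q (1 / 2); rewrite !nnegrE => /(_ (ltW q0) _ q2); lra.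
have a8 : a <= 1 / 8.
  by apply: le_trans q3; rewrite /a ler_wiXn2l // ltW.
have b16 : b <= 1 / 16 by rewrite ba; have := ler_pM (ltW (qp N)) (ltW q0) a8 q2; rewrite -/a; lra.
have -> : N%:R * kappa m ^- 2 * (a * (1 - q) / ((1 - a) * (1 - b))) =
  (N%:R * kappa m ^- 2 * q ^+ (2 * m)) * (q * (1 - q) / ((1 - a) * (1 - b))).
  by rewrite {1}aE; ring.
have h2 : 0 <= q * (1 - q) / ((1 - a) * (1 - b)).
  apply: divr_ge0; apply: mulr_ge0; lra.
apply: (le_trans (ler_wpM2r h2 hd)).
(* The bounds [q <= 1/2], [a <= 1/8], [b <= 1/16] make this at most
   [(3/8) / (1/2 * 7/8 * 15/16) = 32/35], below [19/20]. *)
have -> : 3 * q ^+ 2 / (1 - q) ^+ 2 * (q * (1 - q) / ((1 - a) * (1 - b))) =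
   3 * q ^+ 3 / ((1 - q) * ((1 - a) * (1 - b))).
  by field; rewrite !gt_eqF // subr_gt0.
have h3 : 7 / 8 * (15 / 16) <= (1 - a) * (1 - b) by apply: ler_pM; lra.
have h4 : 1 / 2 * (7 / 8 * (15 / 16)) <= (1 - q) * ((1 - a) * (1 - b)) by apply: ler_pM; lra.
rewrite ler_pdivrMr; lra.
Qed.

Lemma rem_sum_bounds (S : nat) :
  main_piece / 20 <= \sum_(k < m.+1 + S) rem_piece q N P k <= main_piece.
Proof.
have E : \sum_(k < m.+1 + S) rem_piece q N P k =
    main_piece - \sum_(s < S) u (m + s.+1) * B (q ^+ (m + s.+1)).
  rewrite big_split_ord /= big_ord_recr /= big1 ?add0r; last by move=> k _; rewrite rem_piece_lt.
  rewrite rem_piece_m -sumrN; congr (_ + _); apply: eq_bigr => s _.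
  by rewrite addSnnS rem_piece_gt // addnS ltnS leq_addr.
have mk s : (m < m + s.+1)%N by rewrite addnS ltnS leq_addr.
rewrite E; apply/andP; split; last first.
  by rewrite gerBl sumr_ge0 // => s _; rewrite mulr_ge0 ?tail_piece_ge0 ?log_factor_ge0.
suff : \sum_(s < S) u (m + s.+1) * B (q ^+ (m + s.+1)) <= main_piece * (19 / 20) by lra.
apply: (@le_trans _ _ (main_piece *
   (N%:R * (kappa m ^- 2 * \sum_(s < S) ((q ^+ N) ^+ s.+1 * (1 - q ^+ s.+1)))))).
  rewrite !mulr_sumr; apply: ler_sum => s _.
  rewrite [main_piece * _]mulrCA [X in _ <= X]mulrC.
  by apply: ler_pM; rewrite ?tail_piece_ge0 ?log_factor_ge0 ?log_factor_leN ?tail_piece_le.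
by rewrite ler_pM2l ?main_piece_gt0 // tail_ratio.
Qed.

Lemma remainder_bounds : main_piece / 20 <= remainder q N P <= main_piece.
Proof.
have sP : (size P <= N.+1)%N by apply: size_mlqJacobi.
have h := @cvg_rem_pieces R q N P q01 (isT : (0 < N)%N) sP.
have hb K : (m.+1 <= K)%N -> main_piece / 20 <= \sum_(k < K) rem_piece q N P k <= main_piece.
  by move=> mK; have := rem_sum_bounds (K - m.+1); rewrite subnKC.
apply/andP; split.
  apply: (ler_cvg_to (cvg_cst _) h); near=> K.
  have /hb/andP[] // : (m.+1 <= K)%N by near: K; exact: nbhs_infty_ge.
apply: (ler_cvg_to h (cvg_cst _)); near=> K.
have /hb/andP[] // : (m.+1 <= K)%N by near: K; exact: nbhs_infty_ge.
Unshelve. all: by end_near. Qed.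

End Estimates.

(** * Size of the main piece *)

Section MainSize.
Context (R : realType) (p m : nat).
Hypothesis p1 : (1 < p)%N.
Let pR : R := p%:R.
Let q : R := pR^-1.
Let n := m.+1.
Let N := (m.+1 + m)%N.
Let P1 : 1 < pR. Proof. by rewrite ltr1n. Qed.
Let P0 : 0 < pR. Proof. exact: lt_trans ltr01 P1. Qed.
Let Pn0 : pR != 0. Proof. by rewrite gt_eqF. Qed.
Let q01 : 0 < q < 1. Proof. exact: inv_nat01. Qed.
Let q0 : 0 < q. Proof. by case/andP: q01. Qed.
Let q1 : q < 1. Proof. by case/andP: q01. Qed.

Lemma inv_nat_le_half : q <= 1 / 2.
Proof. by rewrite /q div1r lef_pV2 ?posrE // /pR (ler_nat _ 2). Qed.

(** This is [p^(k(k+1)/2)], kept as a product to avoid halves. *)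
Let T (k : nat) : R := \prod_(j < k) pR ^+ j.+1.

Let T_neq0 k : T k != 0.
Proof. by apply/prodf_neq0 => j _; rewrite expf_neq0. Qed.

Lemma pprod_kappa (k : nat) : pprod R p k = T k * kappa q k.
Proof.
rewrite /pprod /T /kappa -big_split /=; apply: eq_bigr => j _.
by rewrite mulrBr mulr1 -exprMn mulfV // expr1n.
Qed.

Lemma T_double (k : nat) : T k.+1 * T k = pR ^+ (k.+1 ^ 2).
Proof.
elim: k => [|k IH]; first by rewrite /T big_ord1 big_ord0 mulr1.
have E j : T j.+1 = T j * pR ^+ j.+1 by rewrite /T big_ord_recr.
rewrite E [X in _ * X]E mulrACA IH -!exprD; congr (_ ^+ _); lia.
Qed.

Lemma kappa_le1 (k : nat) : kappa q k <= 1.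
Proof.
have -> : 1 = \prod_(j < k) (1 : R) by rewrite big1.
apply: ler_prod => j _; rewrite subr_ge0 gerBl exprn_ge0 ?(ltW q0) // andbT.
by rewrite exprn_ile1 // ltW.
Qed.

Lemma kappa_ge (k : nat) : 2 ^- k <= kappa q k.
Proof.
rewrite /kappa -exprVn.
have -> : 2^-1 ^+ k = \prod_(j < k) (2^-1 : R) by rewrite prodr_const card_ord.
apply: ler_prod => j _; rewrite invr_ge0 ler0n /=.
have h : q ^+ j.+1 <= q by rewrite exprS ler_piMr ?(ltW q0) // exprn_ile1 // ltW.
have := inv_nat_le_half; lra.
Qed.

(** All of the main piece except its explicit power of [p]; it stays within [2^(3n)] of [1] in
    ratio, which is negligible on the scale [p^(n^2)]. *)
Let theta : R := kappa q N * kappa q m / kappa q n * (T N.+1 / (nodal_poly N (qnode q)).[q ^+ m]).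

Lemma main_pieceE : main_piece q m = q ^+ (3 * n ^ 2 - n) * theta.
Proof.
rewrite /main_piece -/N (sqr_horner_A_top m q01 inv_nat_le_half).
have Q0 k : \prod_(l < k) q ^+ l != 0.
  by apply/prodf_neq0 => l _; rewrite expf_neq0 // gt_eqF.
have jC : jacobi_const q m.+1 m = pR * pR ^+ N * (T N * kappa q N) /
   ((\prod_(l < m) q ^+ l) ^+ 2 * q ^+ m * (pR ^+ (n ^ 2)) * (kappa q n * kappa q m)).
  rewrite /jacobi_const cofactor_qnode0 // !qroots_qnode // !addn0 pprod0 !divr1 !pprod_kappa.
  rewrite qnode_nat expr1 -/pR -/N -T_double big_ord_recr /=.
  have h1 := T_neq0 n; have h2 := T_neq0 m; have h3 := Q0 m; have h4 : q ^+ m != 0.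
    by rewrite expf_neq0 // gt_eqF.
  have h5 : kappa q n != 0 by rewrite gt_eqF // kappa_gt0.
  have h6 : kappa q m != 0 by rewrite gt_eqF // kappa_gt0.
  rewrite -/n -/q; move: (T n) (T m) (T N) (\prod_(l < m) q ^+ l) (q ^+ m) (kappa q n)
    (kappa q m) (kappa q N) h1 h2 h3 h4 h5 h6 => a1 a2 a3 a4 a5 a6 a7 a8 h1 h2 h3 h4 h5 h6.
  by move: (pR ^+ N) => a9; field; rewrite h1 h2 h3 h4 h5 h6.
rewrite jC /theta.
have TE : T N.+1 = T N * pR ^+ N.+1 by rewrite /T big_ord_recr.
have E1 : q ^- N ^- m.+1 = q ^+ (N * n) by rewrite -exprVn invrK -exprM.
have E2 : pR ^+ (n ^ 2) = (q ^+ (n ^ 2))^-1 by rewrite /q exprVn invrK.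
have E3 : q ^+ (N * n) * q ^+ (n ^ 2) = q ^+ (3 * n ^ 2 - n).
  by rewrite -exprD; congr (_ ^+ _); rewrite /N /n; nia.
rewrite E1 E2 -E3 TE (exprS pR N).
have h1 : q ^+ m != 0 by rewrite expf_neq0 // gt_eqF.
have h2 := Q0 m.
have h3 : kappa q n != 0 by rewrite gt_eqF // kappa_gt0.
have h4 : kappa q m != 0 by rewrite gt_eqF // kappa_gt0.
have h5 : q ^+ (n ^ 2) != 0 by rewrite expf_neq0 // gt_eqF.
have h6 : (nodal_poly N (qnode q)).[q ^+ m] != 0 by rewrite gt_eqF // nodal_gt0.
move: ((nodal_poly N (qnode q)).[q ^+ m]) h6 => w h6.
move: (q ^+ m) (\prod_(l < m) q ^+ l) (kappa q n) (kappa q m) (kappa q N) (q ^+ (n ^ 2))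
  (q ^+ (N * n)) (pR ^+ N) (T N) h1 h2 h3 h4 h5.
move=> a1 a2 a3 a4 a5 a6 a7 a8 a9 h1 h2 h3 h4 h5.
by field; rewrite h1 h2 h3 h4 h5 h6.
Qed.

Lemma nodal_bounds : T N.+1 * kappa q N.+1 <= (nodal_poly N (qnode q)).[q ^+ m] <= T N.+1.
Proof.
rewrite horner_nodal /T /kappa -big_split /=; apply/andP; split; apply: ler_prod => j _.
  rewrite mulr_ge0 ?exprn_ge0 ?(ltW P0) ?subr_ge0 ?exprn_ile1 ?(ltW q0) ?(ltW q1) //=.
  rewrite mulrBr mulr1 -exprMn mulfV // expr1n qnode_nat lerD2l lerN2.
  by rewrite exprn_ile1 // ltW.
rewrite qnode_nat gerBl exprn_ge0 ?(ltW q0) // andbT subr_ge0.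
apply: (@le_trans _ _ 1); first by rewrite exprn_ile1 // ltW.
by rewrite exprn_ege1 // ltW.
Qed.

(** Each [kappa k] lies between [2^-k] and [1], and the nodal value differs from [T N.+1] by at most
    a factor [kappa N.+1]. The exponents add up to at most [3 n]. *)
Lemma theta_bounds : 2 ^- (3 * n) <= theta <= 2 ^+ (3 * n).
Proof.
have n3 : (3 * n = N + m + 2)%N by clear; rewrite /N /n; lia.
have n3' : (3 * n = n + N.+1)%N by clear; rewrite /N /n; lia.
have /andP[w1 w2] := nodal_bounds.
have w0 : 0 < (nodal_poly N (qnode q)).[q ^+ m] by exact: nodal_gt0.
have T0 : 0 < T N.+1 by rewrite prodr_gt0 // => j _; rewrite exprn_gt0.
have k0 k : 0 < kappa q k by apply: kappa_gt0.
have k1 k := kappa_le1 k.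
have kV k : (kappa q k)^-1 <= 2 ^+ k.
  by rewrite -[2 ^+ k]invrK lef_pV2 ?posrE ?invr_gt0 ?exprn_gt0 // kappa_ge.
have r1 : 1 <= T N.+1 / (nodal_poly N (qnode q)).[q ^+ m] by rewrite ler_pdivlMr // mul1r.
have r2 : T N.+1 / (nodal_poly N (qnode q)).[q ^+ m] <= 2 ^+ N.+1.
  apply: le_trans (kV N.+1); rewrite ler_pdivrMr // ler_pdivlMl // mulrC.
  exact: w1.
apply/andP; split.
  apply: (@le_trans _ _ (kappa q N * kappa q m)).
    have -> : 2 ^- (3 * n) = 2 ^- N * 2 ^- m * 2 ^- 2 :> R.
      by rewrite -!invfM -!exprD n3.
    apply: (@le_trans _ _ (2 ^- N * 2 ^- m)).
      by rewrite ler_piMr ?mulr_ge0 ?invr_ge0 ?exprn_ge0 // invf_le1 ?exprn_gt0 // expr2; lra.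
    by apply: ler_pM; rewrite ?invr_ge0 ?exprn_ge0 // kappa_ge.
  rewrite /theta -[X in X <= _]mulr1; apply: ler_pM => //.
    by rewrite mulr_ge0 // ltW.
  by rewrite ler_peMr ?mulr_ge0 ?(ltW (k0 _)) // invf_ge1.
rewrite /theta.
have -> : 2 ^+ (3 * n) = 1 * 1 * 2 ^+ n * 2 ^+ N.+1 :> R.
  by rewrite !mul1r -exprD n3'.
have kn0 k : 0 <= kappa q k by rewrite ltW.
apply: ler_pM => //; last first.
  by apply: ler_pM => //; [exact: mulr_ge0 | rewrite invr_ge0 | apply: ler_pM].
- by rewrite (le_trans ler01).
- by rewrite !mulr_ge0 ?invr_ge0.
Qed.

(** The [4] consists of [1] from the exponent [3 n^2 - n] and [3] from [theta], with [2 <= p];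
    [ln 20] comes from the lower bound [main_piece / 20]. *)
Lemma ln_remainder_bound :
  `|ln (remainder q N (mlqJacobi q m.+1 m)) / ln pR + 3 * n%:R ^+ 2| <=
  (4 + ln 20 / ln pR) * n%:R.
Proof.
have /andP[r1 r2] := remainder_bounds m q01 inv_nat_le_half.
have m0 := main_piece_gt0 m q01 inv_nat_le_half.
set r := remainder _ _ _ in r1 r2 *.
have lp : 0 < ln pR by rewrite ln_gt0.
have l20 : 0 <= ln (20 : R) by rewrite ln_ge0 //; lra.
have l2 : ln 2 <= ln pR by rewrite ler_ln ?posrE // (ler_nat _ 2).
have /andP[t1 t2] := theta_bounds.
have t0 : 0 < theta by apply: lt_le_trans t1; rewrite invr_gt0 exprn_gt0.
have r0 : 0 < r by apply: lt_le_trans r1; rewrite divr_gt0.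
have b1 : ln r <= ln (main_piece q m) by rewrite ler_ln.
have b2 : ln (main_piece q m) - ln 20 <= ln r.
  by rewrite -ln_div ?posrE // ler_ln ?posrE // divr_gt0.
have E : ln (main_piece q m) = - (3 * n%:R ^+ 2 - n%:R) * ln pR + ln theta.
  rewrite main_pieceE lnM ?posrE ?exprn_gt0 // lnXn // lnV ?posrE // -[X in X + _]mulr_natl.
  rewrite natrB ?natrM ?natrX; last by rewrite -mulnn mulnA leq_pmull.
  by congr (_ + _); ring.
have n1 : 1 <= n%:R :> R by rewrite ler1n.
have e2 : ln (2 ^+ (3 * n)) = 3 * n%:R * ln 2 :> R.
  by rewrite lnXn // -[LHS]mulr_natl natrM.
have e3 : 3 * n%:R * ln 2 <= 3 * n%:R * ln pR by rewrite ler_wpM2l.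
have b3 : ln theta <= 3 * n%:R * ln pR.
  by apply: le_trans e3; rewrite -e2 ler_ln ?posrE ?exprn_gt0.
have b4 : - (3 * n%:R * ln pR) <= ln theta.
  apply: (@le_trans _ _ (ln (2 ^- (3 * n)))); last by rewrite ler_ln ?posrE ?invr_gt0 ?exprn_gt0.
  by rewrite lnV ?posrE ?exprn_gt0 // e2 lerN2.
have -> : ln r / ln pR + 3 * n%:R ^+ 2 = (ln r + 3 * n%:R ^+ 2 * ln pR) / ln pR.
  by field; rewrite gt_eqF.
rewrite normrM normfV (gtr0_norm lp) ler_pdivrMr //.
have -> : (4 + ln 20 / ln pR) * n%:R * ln pR = 4 * (n%:R * ln pR) + n%:R * ln 20.
  by field; rewrite gt_eqF.
have b5 : (ln 20 : R) <= n%:R * ln 20 by exact: ler_peMl.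
have b6 : 0 <= n%:R * ln pR by rewrite mulr_ge0 // ltW.
move: b1 b2; rewrite E => b1 b2.
have b7 : - (3 * n%:R ^+ 2 - n%:R) * ln pR + 3 * n%:R ^+ 2 * ln pR = n%:R * ln pR by ring.
have b8 : 3 * n%:R * ln pR = 3 * (n%:R * ln pR) by ring.
rewrite b8 in b3 b4.
by rewrite ler_norml; apply/andP; split; lra.
Qed.

Lemma linear_formE :
  b_ R p n * zeta_q2 q - a_ R p n =
  ((dPhi (2 * n - 1)).[p%:Z])%:~R ^+ 2 * remainder q N (mlqJacobi q n m).
Proof.
rewrite /b_ /a_ /remainder /mlqJ_q /mlqJ_r /= -/pR -/q -/n.
have -> : (2 * n - 1 = N)%N by rewrite /n /N; lia.
have -> : (2 * n - 2 = N.-1)%N by rewrite /n /N; lia.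
have zE : q ^- N = pR ^+ N by rewrite /q exprVn invrK.
have sE : \sum_(0 <= k < N) k%:R * q ^+ k / (1 - q ^+ k) =
    \sum_(1 <= k < N.-1.+1) k%:R / (pR ^+ k - 1).
  rewrite prednK // big_ltn // !mul0r add0r; apply: eq_big_nat => k /andP[k0 _].
  have h1 : q ^+ k != 0 by rewrite expf_neq0 // gt_eqF.
  have h2 : 1 - q ^+ k != 0 by rewrite subr_eq0 gt_eqF // exprn_ilt1 // -?lt0n // ltW.
  have -> : pR ^+ k = (q ^+ k)^-1 by rewrite /q exprVn invrK.
  have -> : (q ^+ k)^-1 - 1 = (1 - q ^+ k) / q ^+ k by rewrite mulrBl mul1r divff.
  by rewrite invf_div mulrA.
rewrite zE sE -/pR; ring.
Qed.

End MainSize.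

(** * The limit *)

Lemma cvg_quadratic (R : realType) (t : nat -> R) (L : R) :
  (forall e : R, 0 < e -> exists K : R, forall m : nat,
     `|t m - L * m.+1%:R ^+ 2| <= e * m.+1%:R ^+ 2 + K * m.+1%:R) ->
  (fun m => t m / m.+1%:R ^+ 2) @ \oo --> L.
Proof.
move=> h; apply/cvgrPdist_le => e e0.
have e2 : 0 < e / 2 by lra.
have [K HK] := h _ e2.
have : (fun m => K * harmonic m) @ \oo --> (0 : R).
  by rewrite -[X in _ --> X](mulr0 K); apply: cvgMr; exact: cvg_harmonic.
move/cvgrPdist_le/(_ _ e2); apply: filterS => m.
rewrite sub0r normrN /harmonic /= => hm.
have m0 : 0 < m.+1%:R :> R by rewrite ltr0n.
have m2 : 0 < m.+1%:R ^+ 2 :> R by rewrite exprn_gt0.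
have -> : L - t m / m.+1%:R ^+ 2 = - ((t m - L * m.+1%:R ^+ 2) / m.+1%:R ^+ 2).
  by move: m0; move: (m.+1%:R) => a a0; field; rewrite gt_eqF.
rewrite normrN normrM normfV (gtr0_norm m2) ler_pdivrMr //.
apply: (le_trans (HK m)).
have h1 : K / m.+1%:R <= e / 2 by apply: le_trans hm; exact: ler_norm.
have h2 : K * m.+1%:R = (K / m.+1%:R) * m.+1%:R ^+ 2.
  by move: m0; move: (m.+1%:R) => a a0; field; rewrite gt_eqF.
rewrite h2 -mulrDl ler_pM2r //; move: (K / _) h1 => a h1; lra.
Qed.

Theorem theorem1p2 (R : realType) (p : nat) (q : R)
  (hp : (1 < p)%N) (hq : q = 1 / p%:R) :
  (forall n : nat, (1 <= n)%N ->
     [/\ a_ R p n \is a Num.int,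
         b_ R p n \is a Num.int
       & b_ R p n * zeta_q2 q - a_ R p n != 0]) /\
  (exists L : R,
     [/\ (fun n : nat => `|b_ R p n * zeta_q2 q - a_ R p n|
                           `^ (1 / n%:R ^+ 2)) @ \oo --> L,
         L <= p%:R `^ (- (3 * (pi ^+ 2 - 8) / pi ^+ 2))
       & p%:R `^ (- (3 * (pi ^+ 2 - 8) / pi ^+ 2)) < 1 :> R]).
Proof.
have p8 := @pi_sqr_gt8 R.
have pR1 : 1 < p%:R :> R by rewrite ltr1n.
have pR0 : 0 < p%:R :> R by rewrite (lt_trans ltr01).
have lp : 0 < ln p%:R :> R by rewrite ln_gt0.
have qE : q = p%:R^-1 by rewrite hq div1r.
have q01 := inv_nat01 R hp; have q2 := inv_nat_le_half R hp.
have rem0 m : 0 < remainder (p%:R^-1 : R) (m.+1 + m) (mlqJacobi p%:R^-1 m.+1 m).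
  have /andP[r1 _] := remainder_bounds m q01 q2.
  by apply: lt_le_trans r1; rewrite divr_gt0 // main_piece_gt0.
have D0 k : 0 < ((dPhi k).[p%:Z])%:~R :> R by rewrite ltr0z dPhi_at_gt0.
have form0 m : 0 < b_ R p m.+1 * zeta_q2 q - a_ R p m.+1.
  by rewrite qE linear_formE // mulr_gt0 // exprn_gt0.
split.
  by case=> // m _; split; [exact: a_is_int | exact: b_is_int | rewrite gt_eqF].
set X := - (3 * (pi ^+ 2 - 8) / pi ^+ 2) : R.
(* The limit equals the stated bound, so the inequality [L <= ...] is reflexivity. *)
exists (p%:R `^ X); split=> //; last first.
  rewrite /powR gt_eqF // expR_lt1 pmulr_llt0 // /X oppr_lt0.
  by apply: divr_gt0; [apply: mulr_gt0; lra | lra].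
(* The shift discards [n = 0], where the exponent is a division by zero. *)
rewrite -cvg_shiftS /=.
pose t (m : nat) : R := 2 * psi R p (2 * m.+1 - 1) +
   ln (remainder (p%:R^-1 : R) (m.+1 + m) (mlqJacobi p%:R^-1 m.+1 m)) / ln p%:R.
have -> : (fun m : nat => `|b_ R p m.+1 * zeta_q2 q - a_ R p m.+1| `^ (1 / m.+1%:R ^+ 2)) =
    (fun m => expR (t m / m.+1%:R ^+ 2 * ln p%:R)).
  apply/funext => m; rewrite gtr0_norm // {1}/powR gt_eqF // qE linear_formE //.
  rewrite lnM ?posrE ?exprn_gt0 // lnXn // /t /psi; congr expR.
  move: (ln _%:~R) (ln (remainder _ _ _)) => a b.
  have m0 : m.+1%:R != 0 :> R by rewrite pnatr_eq0.
  by move: (m.+1%:R) m0 => c c0; rewrite -mulr_natl; field; rewrite c0 gt_eqF.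
have -> : p%:R `^ X = expR (X * ln p%:R) by rewrite /powR gt_eqF.
have ht : (fun m => t m / m.+1%:R ^+ 2 * ln p%:R) @ \oo --> X * ln p%:R.
  apply: cvgMl; apply: cvg_quadratic => e e0.
  (* [psi] is taken at [2n - 1], whose square is at most [4 n^2], and is doubled because [d_N(p)] is
     squared. *)
  have e8 : 0 < e / 8 by lra.
  have [K HK] := psi_asymp hp e8.
  pose M := 4 + ln 20 / ln p%:R : R.
  (* [2 |K|] comes from [psi], [8] from [2c (4n - 1) <= 8n] when [(2n - 1)^2] replaces [4 n^2], and
     [M] from the remainder. *)
  exists (2 * `|K| + 8 + M) => m.
  have := HK (2 * m.+1 - 1)%N; have := ln_remainder_bound R m hp; rewrite -/M /t.
  have -> : (2 * m.+1 - 1)%:R = 2 * m.+1%:R - 1 :> R by rewrite natrB // natrM.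
  have : 1 <= m.+1%:R :> R by rewrite ler1n.
  move: (ln (remainder _ _ _) / _) (psi _ _ _) (m.+1%:R) => l s x x1.
  pose c : R := 3 / pi ^+ 2; rewrite -/c.
  have c0 : 0 < c by rewrite divr_gt0 //; lra.
  have c1 : c <= 1 by rewrite ler_pdivrMr //; lra.
  have -> : X = 8 * c - 3.
    by rewrite /X /c; move: (pi ^+ 2) p8 => a a8; field; rewrite gt_eqF //; lra.
  rewrite !ler_norml => /andP[l1 l2] /andP[s1 s2].
  have k1 := ler_norm K; have k2 : `|K| <= `|K| * x by rewrite ler_peMr.
  have y1 : 4 * x - 1 <= 4 * x by lra.
  have y0 : 0 <= 4 * x - 1 by lra.
  have y2 := ler_pM (ltW c0) y0 c1 y1.
  have y3 := mulr_ge0 (ltW c0) y0.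
  have y4 : e / 8 * (2 * x - 1) ^+ 2 <= e / 8 * (4 * x ^+ 2).
    apply: ler_wpM2l; first exact: ltW.
    by rewrite (_ : 4 * x ^+ 2 = (2 * x - 1) ^+ 2 + (4 * x - 1)); [rewrite lerDl | ring].
  have E : 2 * s + l - (8 * c - 3) * x ^+ 2 =
    2 * (s - c * (2 * x - 1) ^+ 2) + (l + 3 * x ^+ 2) - 2 * (c * (4 * x - 1)) by ring.
  by rewrite E; apply/andP; split; lra.
exact: (cvg_comp _ _ ht (@continuous_expR R _)).
Qed.
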